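(* Let $b_{\rm shunt},I_{\rm shunt}\in\mathbb{R}^n$ be such that (i) $-(B_{\rm red}+[b_{\rm shunt}])$ is an $M$-matrix, and (ii) $I_{\rm shunt}>B_{\rm red}E_L^*$ component-wise. Let $$E_L^{\rm ZI}=(B_{\rm red}+[b_{\rm shunt}])^{-1}(B_{\rm red}E_L^*-I_{\rm shunt})\in\mathbb{R}^n_{>0},\qquad Q_{\rm sc}=[E_L^{\rm ZI}](B_{\rm red}+[b_{\rm shunt}])[E_L^{\rm ZI}]\in\mathbb{R}^{n\times n}.$$ For $Q_L\in\mathbb{R}^n$ consider the ZIP load model $$Q_L^{\rm ZIP}(E_L)=[E_L][b_{\rm shunt}]E_L+[E_L]I_{\rm shunt}+Q_L .$$ If $\|Q_L\|$ is sufficiently small, then there exists a unique high-voltage solution $E_L^{\rm ZIP}\in\mathbb{R}^n_{>0}$ of the reduced power flow equation $$\mathbf 0_n=Q_L^{\rm ZIP}(E_L)+[E_L]B_{\rm red}(E_L-E_L^* ),$$ given by $$E_L^{\rm ZIP}=[E_L^{\rm ZI}]\left(\mathbf 1_n-Q_{\rm sc}^{-1}Q_L+\epsilon\right),$$ where $\|\epsilon\|=\mathcal O(\|Q_{\rm sc}^{-1}Q_L\|^2)$, and the corresponding equilibrium point $(E_L^{\rm ZIP},E_I^{\rm ZIP})$, with $E_I^{\rm ZIP}=W_2\begin{pmatrix}E_L^{\rm ZIP}\\ E_I^*\end{pmatrix}$, of the closed-loop differential-algebraic system $$\begin{pmatrix}\mathbf 0_n\\ \tau_I\dot E_I\end{pmatrix}=\begin{pmatrix}Q_L^{\rm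 ZIP}(E_L)\\ [E_I]K_I(E_I-E_I^* )\end{pmatrix}+[E]BE,\qquad E=(E_L,E_I),$$ is locally exponentially stable.
   Context: Network: $n,m\ge 1$ are integers, $\mathcal L=\{1,\dots,n\}$ is the set of load buses, $\mathcal I=\{n+1,\dots,n+m\}$ the set of inverter buses, and $G$ is a connected undirected weighted graph on $\mathcal L\cup\mathcal I$ with edge set $\mathcal E$. The susceptance matrix $B\in\mathbb{R}^{(n+m)\times(n+m)}$ is symmetric with $B_{ij}=B_{ji}>0$ if $\{i,j\}\in\mathcal E$, $B_{ij}=0$ for $i\neq j$ with $\{i,j\}\notin\mathcal E$, and $B_{ii}=-\sum_{j\ne i}B_{ij}$. For a vector $x$, $[x]$ is the diagonal matrix with $x$ on the diagonal; $\mathbf 0_n$ and $\mathbf 1_n$ are the vectors of zeros and ones. Block partition according to loads and inverters: $E=(E_L,E_I)$ and $B=\begin{pmatrix}B_{LL}&B_{LI}\\ B_{IL}&B_{II}\end{pmatrix}$. The diagonal matrix $K_I=\mathrm{diag}(K_i)_{i\in\mathcal I}$ contains controller gains $K_i<0$, $\tau_I=\mathrm{diag}(\tau_i)_{i\in\mathcal I}$ time constants $\tau_i>0$, and $E_I^*=(E_i^* )_{i\in\mathcal I}\in\mathbb{R}^m_{>0}$ voltage set points. Define $$B_{\rm red}=B_{LL}-B_{LI}(B_{II}+K_I)^{-1}B_{IL},\qquad W_1=-B_{\rm red}^{-1}B_{LI}(B_{II}+K_I)^{-1}K_I,$$ $$W_2=(B_{II}+K_I)^{-1}\begin{pmatrix}-B_{IL}&K_I\end{pmatrix},\qquad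 E_L^*=W_1E_I^*.$$ (The inverses exist.) A real square matrix $A$ is an $M$-matrix if $A_{ij}\le0$ for all $i\ne j$ and all eigenvalues of $A$ have positive real parts. The vector $E_L^{\rm ZI}$ is the unique positive solution of the reduced power flow equation when $Q_L=\mathbf 0_n$. ''Unique high-voltage solution'' means the solution close to $E_L^{\rm ZI}$: there are $\delta>0$, $c>0$ and a neighborhood $U\subset\mathbb{R}^n_{>0}$ of $E_L^{\rm ZI}$ (depending only on the network, controller and ZI data) such that for every $Q_L$ with $\|Q_L\|<\delta$ the equation has exactly one solution $E_L^{\rm ZIP}$ in $U$; the order estimate means $\|\epsilon\|\le c\|Q_{\rm sc}^{-1}Q_L\|^2$ for all such $Q_L$. An equilibrium of a differential-algebraic system is locally exponentially stable if there are $\delta',c',\lambda>0$ such that from every initial condition satisfying the algebraic equations and at distance less than $\delta'$ from the equilibrium there is a unique continuous solution for all $t\ge0$, and its distance to the equilibrium at time $t$ is at most $c'e^{-\lambda t}$ times the initial distance. *)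

(* Defs.v *)
From HB Require Import structures.
From mathcomp Require Import all_boot all_order all_algebra.
From mathcomp Require Import complex.
From mathcomp Require Import all_classical all_reals all_analysis.

Set Implicit Arguments.
Unset Strict Implicit.
Unset Printing Implicit Defensive.

Import Order.TTheory GRing.Theory Num.Theory.
Import numFieldNormedType.Exports.

Local Open Scope classical_set_scope.
Local Open Scope ring_scope.

(* Vectors are column vectors; `|x| is the maximum norm.  The n loads are the *)
(* first n indices of 'I_(n + m) and the m inverters the last m, so that the  *)
(* load/inverter blocks of a vector or of B are its usubmx/dsubmx and         *)
(* ulsubmx/ursubmx/dlsubmx/drsubmx.                                           *)

(* The diagonal matrix [x]; diag_mx takes a row vector. *)
Definition dg (R : pzRingType) (n : nat) (x : 'cV[R]_n) : 'M[R]_n :=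
  diag_mx x^T.

Definition ones (R : pzRingType) (n : nat) : 'cV[R]_n := const_mx 1.

Definition pos_vec (R : numDomainType) (n : nat) (x : 'cV[R]_n) : Prop :=
  forall i, 0 < x i 0.

Definition connected_graph (T : finType) (e : rel T) : Prop :=
  [/\ symmetric e, irreflexive e & forall x y, connect e x y].

Definition susceptance_matrix (R : numDomainType) (N : nat) (e : rel 'I_N)
    (B : 'M[R]_N) : Prop :=
  [/\ forall i j, B i j = B j i,
      forall i j, e i j -> 0 < B i j,
      forall i j, i != j -> ~~ e i j -> B i j = 0 &
      forall i, B i i = - \sum_(j | j != i) B i j].

Definition M_matrix (R : rcfType) (n : nat) (A : 'M[R]_n) : Prop :=
  (forall i j, i != j -> A i j <= 0) /\
  (forall a : R[i], eigenvalue (map_mx (real_complex R) A) a ->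
    0 < complex.Re a).

Definition Bred (R : comUnitRingType) (n m : nat) (B : 'M[R]_(n + m))
    (K : 'cV[R]_m) : 'M[R]_n :=
  ulsubmx B - ursubmx B *m invmx (drsubmx B + dg K) *m dlsubmx B.

Definition W1 (R : comUnitRingType) (n m : nat) (B : 'M[R]_(n + m))
    (K : 'cV[R]_m) : 'M[R]_(n, m) :=
  - (invmx (Bred B K) *m ursubmx B *m invmx (drsubmx B + dg K) *m dg K).

Definition W2 (R : comUnitRingType) (n m : nat) (B : 'M[R]_(n + m))
    (K : 'cV[R]_m) : 'M[R]_(m, n + m) :=
  invmx (drsubmx B + dg K) *m row_mx (- dlsubmx B) (dg K).

Definition ELstar (R : comUnitRingType) (n m : nat) (B : 'M[R]_(n + m))
    (K EIstar : 'cV[R]_m) : 'cV[R]_n :=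
  W1 B K *m EIstar.

Definition EL_ZI (R : comUnitRingType) (n m : nat) (B : 'M[R]_(n + m))
    (K EIstar : 'cV[R]_m) (b I : 'cV[R]_n) : 'cV[R]_n :=
  invmx (Bred B K + dg b) *m (Bred B K *m ELstar B K EIstar - I).

Definition Qsc (R : comUnitRingType) (n m : nat) (B : 'M[R]_(n + m))
    (K EIstar : 'cV[R]_m) (b I : 'cV[R]_n) : 'M[R]_n :=
  dg (EL_ZI B K EIstar b I) *m (Bred B K + dg b) *m
  dg (EL_ZI B K EIstar b I).

Definition QL_ZIP (R : comUnitRingType) (n : nat) (b I QL EL : 'cV[R]_n) :
    'cV[R]_n :=
  dg EL *m dg b *m EL + dg EL *m I + QL.

Definition reduced_power_flow (R : comUnitRingType) (n m : nat)
    (B : 'M[R]_(n + m)) (K EIstar : 'cV[R]_m) (b I QL EL : 'cV[R]_n) : Prop :=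
  0 = QL_ZIP b I QL EL + dg EL *m Bred B K *m (EL - ELstar B K EIstar).

Definition EI_of (R : comUnitRingType) (n m : nat) (B : 'M[R]_(n + m))
    (K EIstar : 'cV[R]_m) (EL : 'cV[R]_n) : 'cV[R]_m :=
  W2 B K *m col_mx EL EIstar.

Definition closed_loop_rhs (R : comUnitRingType) (n m : nat)
    (B : 'M[R]_(n + m)) (K EIstar : 'cV[R]_m) (b I QL : 'cV[R]_n)
    (E : 'cV[R]_(n + m)) : 'cV[R]_(n + m) :=
  col_mx (QL_ZIP b I QL (usubmx E))
         (dg (dsubmx E) *m dg K *m (dsubmx E - EIstar))
  + dg E *m B *m E.

(* v is the derivative of f at t relative to the half-line [0, +oo[ : the     *)
(* two-sided derivative if 0 < t, the right derivative if t = 0.              *)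
Definition has_halfline_derivative (R : realType) (V : normedModType R)
    (f : R -> V) (t : R) (v : V) : Prop :=
  h^-1 *: (f (t + h) - f t) @[h --> within [set h | 0 <= t + h] 0^'] --> v.

(* The differential-algebraic system (0_n, [tau] x_I') = rhs x, for           *)
(* x = (x_L, x_I); only the values of x on [0, +oo[ matter.                   *)
Definition dae_solution (R : realType) (n m : nat) (tau : 'cV[R]_m)
    (rhs : 'cV[R]_(n + m) -> 'cV[R]_(n + m)) (x : R -> 'cV[R]_(n + m)) : Prop :=
  {within `[0, +oo[, continuous x} /\
  forall t, 0 <= t ->
    exists2 v : 'cV[R]_m,
      has_halfline_derivative (fun s => dsubmx (x s)) t v &
      col_mx 0 (dg tau *m v) = rhs (x t).

Definition dae_consistent (R : realType) (n m : nat)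
    (rhs : 'cV[R]_(n + m) -> 'cV[R]_(n + m)) (x0 : 'cV[R]_(n + m)) : Prop :=
  0 = usubmx (rhs x0).

Definition dae_equilibrium (R : realType) (n m : nat)
    (rhs : 'cV[R]_(n + m) -> 'cV[R]_(n + m)) (xe : 'cV[R]_(n + m)) : Prop :=
  0 = rhs xe.

Definition locally_exponentially_stable (R : realType) (n m : nat)
    (tau : 'cV[R]_m) (rhs : 'cV[R]_(n + m) -> 'cV[R]_(n + m))
    (xe : 'cV[R]_(n + m)) : Prop :=
  dae_equilibrium rhs xe /\
  exists delta c lambda : R,
    [/\ 0 < delta, 0 < c, 0 < lambda &
      forall x0, dae_consistent rhs x0 -> `|x0 - xe| < delta ->
        exists x : R -> 'cV[R]_(n + m),
          [/\ x 0 = x0,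
              dae_solution tau rhs x,
              forall y, y 0 = x0 -> dae_solution tau rhs y ->
                forall t, 0 <= t -> y t = x t &
              forall t, 0 <= t ->
                `|x t - xe| <= c * expR (- lambda * t) * `|x0 - xe|]].

(* Main.v *)
Require Import Defs.
From HB Require Import structures.
From mathcomp Require Import all_boot all_order all_algebra.
From mathcomp Require Import complex ring lra.
From mathcomp Require Import all_classical all_reals all_analysis.

Set Implicit Arguments.
Unset Strict Implicit.
Unset Printing Implicit Defensive.

Import Order.TTheory GRing.Theory Num.Theory.
Import numFieldNormedType.Exports.

Local Open Scope classical_set_scope.
Local Open Scope ring_scope.

(** Put [H = - (B + dg (b, K))], the matrix [augmented B b K]. Dividing by the
    voltages, the equilibrium equations read [H E = J + (q / E_L, 0)] with
    [J = (I, - dg K EIstar)], and the load rows, after elimination of [E_I],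
    read [A x = y + q / x] with [A = - (Bred + dg b)]. So [A] is the Schur
    complement of the inverter block of [H]. The M-matrix hypothesis and the
    symmetry of [A] make it coercive ([sym_M_matrix_coercive]); the inverter
    block is coercive because [K < 0] and Laplacian forms are nonnegative;
    completing the square makes [H] coercive ([schur_coercive]).

    Power flow. For [q = 0] the solution [EZI = A^-1 y] is positive because [A]
    is a coercive matrix with nonpositive off-diagonal entries
    ([coercive_Zmatrix_pos]). For small [q] the map
    [x |-> A^-1 (y + q / x)] contracts near [EZI]. Truncating the denominator
    from below by [eps] makes it a contraction of the whole space, which gives
    existence, uniqueness in a ball on which the voltages exceed [eps], and
    Lipschitz dependence on [y] ([trunc_solution_exists], [trunc_solution_lip]).
    The fixed point equation also yields the second-order expansion
    ([short_circuit_expansion]).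

    Stability ([zip_stable]). The algebraic equation is of the same form, with
    [ulsubmx H] in place of [A], so near the equilibrium it defines the load
    voltages as a Lipschitz function [phi] of the inverter voltages [z]
    ([load_map_exists]). What remains is [tau_i z_i' = z_i g_i(z)], where
    coercivity of [H], together with the smallness of [q], gives
    [(z - c) . g(z) <= - (mu / 2) |z - c|^2] ([load_balance_monotone]). A
    weighted sum of squares is then a strict Lyapunov function near the
    equilibrium [c] ([reduced_decay]); this argument does not differentiate
    [phi]. Global solutions come from Picard iteration for the field composed
    with the retraction onto a box ([ode_global_solution]), which the decay
    estimate shows is never left. Uniqueness among all continuous solutions of
    the differential-algebraic system comes from Gronwall's inequality, applied
    on short intervals and continued along the time axis ([real_induction]). *)

(** * Euclidean pairing, maximum norm and coercive matrices *)

Definition sdot (R : pzRingType) (n : nat) (x y : 'cV[R]_n) : R :=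
  \sum_i x i 0 * y i 0.

Definition coercive (R : numDomainType) (n : nat) (mu : R) (A : 'M[R]_n) :=
  forall x : 'cV[R]_n, mu * sdot x x <= sdot x (A *m x).

Lemma coordD (R : nmodType) (n : nat) (x y : 'cV[R]_n) i :
  (x + y) i 0 = x i 0 + y i 0.
Proof. by rewrite mxE. Qed.

Lemma coordN (R : zmodType) (n : nat) (x : 'cV[R]_n) i : (- x) i 0 = - x i 0.
Proof. by rewrite mxE. Qed.

Lemma coordB (R : zmodType) (n : nat) (x y : 'cV[R]_n) i :
  (x - y) i 0 = x i 0 - y i 0.
Proof. by rewrite !mxE. Qed.

Lemma sdotE (R : pzRingType) (n : nat) (x y : 'cV[R]_n) :
  sdot x y = (x^T *m y) 0 0.
Proof. by rewrite mxE; apply: eq_bigr => i _; rewrite mxE. Qed.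

Lemma sdotC (R : comPzRingType) (n : nat) (x y : 'cV[R]_n) :
  sdot x y = sdot y x.
Proof. by apply: eq_bigr => i _; rewrite mulrC. Qed.

Lemma sdotDl (R : pzRingType) (n : nat) (x y z : 'cV[R]_n) :
  sdot (x + y) z = sdot x z + sdot y z.
Proof. by rewrite -big_split; apply: eq_bigr => i _; rewrite mxE mulrDl. Qed.

Lemma sdotDr (R : pzRingType) (n : nat) (x y z : 'cV[R]_n) :
  sdot z (x + y) = sdot z x + sdot z y.
Proof. by rewrite -big_split; apply: eq_bigr => i _; rewrite mxE mulrDr. Qed.

Lemma sdotNr (R : pzRingType) (n : nat) (x y : 'cV[R]_n) :
  sdot x (- y) = - sdot x y.
Proof. by rewrite -sumrN; apply: eq_bigr => i _; rewrite mxE mulrN. Qed.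

Lemma sdot0r (R : pzRingType) (n : nat) (x : 'cV[R]_n) : sdot x 0 = 0.
Proof. by apply: big1 => j _; rewrite mxE mulr0. Qed.

Lemma sdot_mul (R : comPzRingType) (n p : nat) (A : 'M[R]_(n, p)) x y :
  sdot x (A *m y) = sdot (A^T *m x) y.
Proof. by rewrite !sdotE trmx_mul trmxK mulmxA. Qed.

Lemma sdot_col (R : pzRingType) (n m : nat) (x x' : 'cV[R]_n)
    (y y' : 'cV[R]_m) :
  sdot (col_mx x y) (col_mx x' y') = sdot x x' + sdot y y'.
Proof.
rewrite /sdot big_split_ord; congr (_ + _); apply: eq_bigr => i _.
  by rewrite !col_mxEu.
by rewrite !col_mxEd.
Qed.

Lemma sdot_ge0 (R : realDomainType) (n : nat) (x : 'cV[R]_n) : 0 <= sdot x x.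
Proof. by apply: sumr_ge0 => i _; rewrite -expr2 sqr_ge0. Qed.

Lemma sdot_eq0 (R : realDomainType) (n : nat) (x : 'cV[R]_n) :
  sdot x x <= 0 -> x = 0.
Proof.
move=> x0; have : sdot x x = 0 by apply/eqP; rewrite eq_le x0 sdot_ge0.
move/eqP; rewrite psumr_eq0 => [/allP h|i _]; last by rewrite -expr2 sqr_ge0.
apply/colP => i; rewrite mxE; apply/eqP.
by have := h i (mem_index_enum _); rewrite mulf_eq0 orbb.
Qed.

Lemma norm_coord (R : realType) (m n : nat) (x : 'M[R]_(m, n)) i j :
  `|x i j| <= `|x|.
Proof.
rewrite [leRHS]mx_normrE.
exact: (le_bigmax_cond 0 (fun ij => `|x ij.1 ij.2|) (j := (i, j))) isT.
Qed.

Lemma cvnorm_le (R : realType) (n : nat) (x : 'cV[R]_n) (r : R) :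
  0 <= r -> (forall i, `|x i 0| <= r) -> `|x| <= r.
Proof.
move=> r0 h; rewrite [leLHS]mx_normrE; apply: bigmax_le => // -[i j] _ /=.
by rewrite (ord1 j).
Qed.

Lemma norm_usubmx (R : realType) (n m : nat) (x : 'cV[R]_(n + m)) :
  `|usubmx x| <= `|x|.
Proof. by apply: cvnorm_le => // i; rewrite mxE norm_coord. Qed.

Lemma norm_dsubmx (R : realType) (n m : nat) (x : 'cV[R]_(n + m)) :
  `|dsubmx x| <= `|x|.
Proof. by apply: cvnorm_le => // i; rewrite mxE norm_coord. Qed.

Lemma norm_col_mx (R : realType) (n m : nat) (x : 'cV[R]_n) (y : 'cV[R]_m) :
  `|col_mx x y| <= `|x| + `|y|.
Proof.
apply: cvnorm_le => [|i]; first exact: addr_ge0.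
case: (split_ordP i) => j ->.
  by rewrite col_mxEu (le_trans (norm_coord x j 0)) // lerDl.
by rewrite col_mxEd (le_trans (norm_coord y j 0)) // lerDr.
Qed.

Lemma sqr_norm_le (R : realType) (n : nat) (x : 'cV[R]_n) :
  `|x| ^+ 2 <= sdot x x.
Proof.
have [->|x0] := eqVneq `|x| 0; first by rewrite expr0n sdot_ge0.
have [[i j] /= normE] := mx_norm_neq0 x0.
rewrite [`|x|]normE ord1 real_normK ?num_real // /sdot (bigD1 i) //= -expr2.
by rewrite lerDl sumr_ge0 // => l _; rewrite -expr2 sqr_ge0.
Qed.

Lemma sdot_le_norm (R : realType) (n : nat) (x y : 'cV[R]_n) :
  `|sdot x y| <= n%:R * (`|x| * `|y|).
Proof.
rewrite (le_trans (ler_norm_sum _ _ _)) //.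
have -> : n%:R * (`|x| * `|y|) = \sum_(i < n) `|x| * `|y|.
  by rewrite sumr_const card_ord mulr_natl.
by apply: ler_sum => i _; rewrite normrM ler_pM // norm_coord.
Qed.

Lemma mulmx_bounded (R : realType) (m n : nat) (M : 'M[R]_(m, n)) :
  exists2 C : R, 0 <= C & forall x : 'cV[R]_n, `|M *m x| <= C * `|x|.
Proof.
exists (n%:R * `|M|) => [|x]; first exact: mulr_ge0.
apply: cvnorm_le => [|i]; first by rewrite !mulr_ge0.
rewrite mxE (le_trans (ler_norm_sum _ _ _)) //.
have -> : n%:R * `|M| * `|x| = \sum_(j < n) `|M| * `|x|.
  by rewrite sumr_const card_ord mulr_natl mulrnAl.
by apply: ler_sum => j _; rewrite normrM ler_pM // norm_coord.
Qed.

Lemma mulmx_inj_unit (R : fieldType) (n : nat) (A : 'M[R]_n) :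
  (forall x : 'cV[R]_n, A *m x = 0 -> x = 0) -> A \in unitmx.
Proof.
move=> injA; rewrite -unitmx_tr -row_free_unit -kermx_eq0.
apply/eqP/row_matrixP => i; rewrite row0; apply: trmx_inj; rewrite trmx0.
apply: injA; apply: trmx_inj.
by rewrite trmx_mul trmxK trmx0 -row_mul mulmx_ker row0.
Qed.

Lemma coercive_unit (R : realFieldType) (n : nat) (mu : R) (A : 'M[R]_n) :
  0 < mu -> coercive mu A -> A \in unitmx.
Proof.
move=> mu0 cA; apply: mulmx_inj_unit => x Ax; apply: sdot_eq0.
by have := cA x; rewrite Ax sdot0r pmulr_rle0.
Qed.

(** Pairing [A x = y > 0] with the negative part of [x] gives [x >= 0]; at a
    vanishing entry the row of [A] would contribute only nonpositive terms. *)
Lemma coercive_Zmatrix_pos (R : realFieldType) (n : nat) (mu : R)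
    (A : 'M[R]_n) (x : 'cV[R]_n) :
  0 < mu -> coercive mu A -> (forall i j, i != j -> A i j <= 0) ->
  pos_vec (A *m x) -> pos_vec x.
Proof.
move=> mu0 cA offdiag Ax0.
pose z : 'cV[R]_n := \col_i Num.max 0 (- x i 0).
have z0 i : 0 <= z i 0 by rewrite mxE le_max lexx.
have zx i : 0 <= x i 0 + z i 0 by rewrite mxE; case: (leP 0 (- x i 0)); lra.
have zxz i : z i 0 * (x i 0 + z i 0) = 0.
  by rewrite mxE; case: (leP 0 (- x i 0)) => _; rewrite ?mul0r // addrN mulr0.
have le0 : sdot z (A *m z) <= 0.
  have -> : A *m z = A *m (x + z) - A *m x by rewrite mulmxDr addrC addKr.
  rewrite sdotDr sdotNr subr_le0.
  apply: (@le_trans _ _ 0).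
    apply: sumr_le0 => i _; rewrite [X in _ * X]mxE mulr_sumr.
    apply: sumr_le0 => j _.
    have [<-|ij] := eqVneq i j.
      by rewrite [X in _ * (_ * X)]mxE mulrCA zxz mulr0.
    rewrite mulrA mulr_le0_ge0 //; last by rewrite mxE; exact: zx.
    by rewrite mulr_ge0_le0 // offdiag.
  by apply: sumr_ge0 => i _; rewrite mulr_ge0 // ltW.
have zE : z = 0.
  apply: sdot_eq0; have := le_trans (cA z) le0; by rewrite pmulr_rle0.
have x0 i : 0 <= x i 0 by have := zx i; rewrite zE [X in _ + X]mxE addr0.
move=> i; rewrite lt_neqAle x0 andbT eq_sym; apply/eqP => xi.
have := Ax0 i; rewrite mxE; apply/negP; rewrite -leNgt.
apply: sumr_le0 => j _; have [<-|ij] := eqVneq i j; first by rewrite xi mulr0.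
by rewrite mulr_le0_ge0 // offdiag.
Qed.

Lemma exists_pos_lower_bound (R : realFieldType) (T : finType) (f : T -> R) :
  (forall i, 0 < f i) -> exists2 mu : R, 0 < mu & forall i, mu <= f i.
Proof.
move=> f0; exists (\big[Num.min/1]_i f i); first by apply: lt_bigmin.
by move=> i; apply: bigmin_le_cond.
Qed.

(** The unitary diagonalisation [A = P^* D P] turns the quadratic form into
    [\sum_i D_i |(P x)_i|^2], and the entries of [D] are eigenvalues. *)
Lemma sym_M_matrix_coercive (R : realType) (n : nat) (A : 'M[R]_n) :
  A^T = A -> M_matrix A -> exists2 mu : R, 0 < mu & coercive mu A.
Proof.
move=> symA [_ eigA].
pose toC := real_complex R.
pose Ac : 'M[R[i]]_n := map_mx toC A.
have conjr (r : R) : Num.conj (toC r) = toC r 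
  by rewrite conj_Creal // /toC complex_real eqxx.
have AcT p q (M : 'M[R]_(p, q)) :
    map_mx Num.conj (map_mx toC M)^T = map_mx toC M^T.
  by apply/matrixP => i j; rewrite !mxE conjr.
have /orthomx_spectralP AE : Ac \is normalmx.
  by apply/normalmxP; rewrite AcT symA.
set P := spectralmx Ac in AE; set D := spectral_diag Ac in AE.
have Pu : P \is unitarymx := spectral_unitarymx Ac.
have PPV : invmx P *m P = 1%:M by rewrite mulVmx // unitarymx_unit.
have D0 i : 0 < complex.Re (D 0 i).
  apply: eigA; apply/eigenvalueP; exists (row i P).
    rewrite -row_mul -/toC -/Ac AE !mulmxA mulmxV ?unitarymx_unit // mul1mx.
    by rewrite row_mul row_diag_mx -scalemxAl rowE.
  apply/negP => /eqP rP0; have /unitarymxP/row_matrixP/(_ i) := Pu.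
  rewrite row_mul rP0 mul0mx => /rowP /(_ i).
  by rewrite !mxE eqxx => /eqP; rewrite eq_sym oner_eq0.
have [mu mu0 muD] := exists_pos_lower_bound D0.
exists mu => // x.
pose v := P *m map_mx toC x.
have vT : map_mx Num.conj v^T = map_mx toC x^T *m invmx P.
  by rewrite trmx_mul map_mxM /= AcT invmx_unitary.
pose c i : R := complex.Re ((v i 0)^* * v i 0).
have cv i : (v i 0)^* * v i 0 = `|v i 0| ^+ 2 by rewrite normCK mulrC.
have cE i : (v i 0)^* * v i 0 = toC (c i).
  by rewrite /toC RRe_real // cv rpredX // normr_real.
have c0 i : 0 <= c i.
  have : 0 <= toC (c i) by rewrite -cE cv exprn_ge0.
  by rewrite lecE => /andP[].
have toC_sdot (y z : 'cV[R]_n) :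
    toC (sdot y z) = (map_mx toC y^T *m map_mx toC z) 0 0.
  by rewrite sdotE -map_mxM [RHS]mxE.
have Re_sum (f : 'I_n -> R[i]) :
    complex.Re (\sum_i f i) = \sum_i complex.Re (f i).
  by apply: (big_morph (@complex.Re R)) => // -[a b] [a' b'].
have normE : toC (sdot x x) = \sum_i toC (c i).
  rewrite toC_sdot -[map_mx toC x]mul1mx -PPV -mulmxA mulmxA -vT mxE.
  apply: eq_bigr => i _; rewrite -cE; congr (_ * _).
  by rewrite mxE mxE.
have formE : toC (sdot x (A *m x)) = \sum_i D 0 i * toC (c i).
  rewrite toC_sdot map_mxM /= -/Ac AE -!mulmxA -/v mulmxA -vT mxE.
  apply: eq_bigr => i _; rewrite -cE mulrCA; congr (_ * _).
    by rewrite mxE mxE.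
  by rewrite mul_diag_mx mxE.
have := congr1 (@complex.Re R) normE; rewrite Re_sum /= => ->.
have := congr1 (@complex.Re R) formE; rewrite Re_sum /= => ->.
rewrite mulr_sumr; apply: ler_sum => i _.
have -> : complex.Re (D 0 i * toC (c i)) = complex.Re (D 0 i) * c i.
  by case: (D 0 i) => a b; rewrite /toC /=; ring.
exact: ler_wpM2r.
Qed.

(** * The augmented susceptance matrix and its Schur complement *)

Definition augmented (R : pzRingType) (n m : nat) (B : 'M[R]_(n + m))
    (b : 'cV[R]_n) (K : 'cV[R]_m) : 'M[R]_(n + m) :=
  - (B + dg (col_mx b K)).

Lemma dgE (R : pzRingType) (n : nat) (x : 'cV[R]_n) i j :
  dg x i j = x i 0 *+ (i == j).
Proof. by rewrite /dg !mxE; case: eqP => // ->. Qed.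

Lemma mul_dgE (R : pzRingType) (n : nat) (x y : 'cV[R]_n) i :
  (dg x *m y) i 0 = x i 0 * y i 0.
Proof. by rewrite /dg mul_diag_mx !mxE. Qed.

Lemma tr_dg (R : pzRingType) (n : nat) (x : 'cV[R]_n) : (dg x)^T = dg x.
Proof. exact: tr_diag_mx. Qed.

Lemma dg_col_mx (R : pzRingType) (n m : nat) (x : 'cV[R]_n) (y : 'cV[R]_m) :
  dg (col_mx x y) = block_mx (dg x) 0 0 (dg y).
Proof. by rewrite /dg tr_col_mx diag_mx_row. Qed.

Lemma augmentedE (R : pzRingType) (n m : nat) (B : 'M[R]_(n + m))
    (b : 'cV[R]_n) (K : 'cV[R]_m) :
  augmented B b K = block_mx (- (ulsubmx B + dg b)) (- ursubmx B)
                             (- dlsubmx B) (- (drsubmx B + dg K)).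
Proof.
rewrite /augmented dg_col_mx -{1}(submxK B) add_block_mx opp_block_mx.
by rewrite !addr0.
Qed.

Lemma unitmxN (R : comUnitRingType) (n : nat) (A : 'M[R]_n) :
  (- A \in unitmx) = (A \in unitmx).
Proof. by rewrite -scaleN1r unitmxZ // unitrN1. Qed.

Lemma invmxN (R : comUnitRingType) (n : nat) (A : 'M[R]_n) :
  A \in unitmx -> invmx (- A) = - invmx A.
Proof.
move=> uA; rewrite -scaleN1r invmxZ ?invrN1 ?scaleN1r //.
by rewrite unitmxN.
Qed.

(** With symmetry and zero row sums, the quadratic form of [- B] is the sum over
    edges of the squared differences, weighted by [B]. *)
Lemma laplacian_form (R : realFieldType) (N : nat) (B : 'M[R]_N) x :
  (forall i j, B i j = B j i) -> (forall i, \sum_j B i j = 0) ->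
  2 * sdot x (- B *m x) = \sum_i \sum_j B i j * (x i 0 - x j 0) ^+ 2.
Proof.
move=> symB rowB.
have e0 : \sum_i \sum_j B i j * x i 0 ^+ 2 = 0.
  by rewrite big1 // => i _; rewrite -mulr_suml rowB mul0r.
have e1 : \sum_i \sum_j B i j * x j 0 ^+ 2 = 0.
  rewrite exchange_big /= -[RHS]e0; apply: eq_bigr => i _.
  by apply: eq_bigr => j _; rewrite symB.
have -> : 2 * sdot x (- B *m x) =
    \sum_i \sum_j (- 2) * (x i 0 * (B i j * x j 0)).
  rewrite mulr_sumr; apply: eq_bigr => i _.
  by rewrite mulNmx mxE mxE mulrN mulrN -mulNr mulr_sumr mulr_sumr.
rewrite -[LHS]add0r -{1}e1 -[LHS]add0r -{1}e0 -!big_split /=.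
apply: eq_bigr => i _; rewrite -!big_split /=.
by apply: eq_bigr => j _; ring.
Qed.

Lemma susceptance_row_sum (R : numDomainType) (N : nat) (e : rel 'I_N)
    (B : 'M[R]_N) : susceptance_matrix e B -> forall i, \sum_j B i j = 0.
Proof. by case=> _ _ _ diagB i; rewrite (bigD1 i) //= diagB addNr. Qed.

Lemma susceptance_offdiag (R : numDomainType) (N : nat) (e : rel 'I_N)
    (B : 'M[R]_N) i j : susceptance_matrix e B -> i != j -> 0 <= B i j.
Proof.
case=> _ posB zeroB _ ij; have [/posB/ltW //|/zeroB->//] := boolP (e i j).
Qed.

Lemma laplacian_ge0 (R : realFieldType) (N : nat) (e : rel 'I_N)
    (B : 'M[R]_N) x : susceptance_matrix e B -> 0 <= sdot x (- B *m x).
Proof.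
move=> hB; have [symB _ _ _] := hB.
rewrite -(pmulr_rge0 _ (ltr0n R 2)) laplacian_form //; last first.
  exact: susceptance_row_sum hB.
apply: sumr_ge0 => i _; apply: sumr_ge0 => j _.
have [->|ij] := eqVneq i j; first by rewrite subrr expr0n mulr0.
by rewrite mulr_ge0 ?sqr_ge0 ?(susceptance_offdiag hB).
Qed.

(** The kernel of the Laplacian of a connected graph: the form vanishes only if
    [x] takes equal values along every edge. *)
Lemma laplacian_kernel (R : realFieldType) (N : nat) (e : rel 'I_N)
    (B : 'M[R]_N) x : connected_graph e -> susceptance_matrix e B ->
  sdot x (- B *m x) <= 0 -> forall i j, x i 0 = x j 0.
Proof.
move=> [_ irre conn] hB x0; have [symB posB _ _] := hB.
have term0 i j : 0 <= B i j * (x i 0 - x j 0) ^+ 2.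
  have [->|ij] := eqVneq i j; first by rewrite subrr expr0n mulr0.
  by rewrite mulr_ge0 ?sqr_ge0 ?(susceptance_offdiag hB).
have : \sum_i \sum_j B i j * (x i 0 - x j 0) ^+ 2 = 0.
  apply/eqP; rewrite eq_le sumr_ge0 ?andbT => [|i _]; last exact: sumr_ge0.
  rewrite -laplacian_form //; last exact: susceptance_row_sum hB.
  by rewrite pmulr_rle0.
move/eqP; rewrite psumr_eq0 => [/allP sum0|i _]; last exact: sumr_ge0.
have edge i j : e i j -> x i 0 = x j 0.
  move=> eij; have := sum0 i (mem_index_enum _); rewrite /= psumr_eq0 //.
  move=> /allP /(_ j (mem_index_enum _)) /=.
  by rewrite mulf_eq0 gt_eqF ?posB //= sqrf_eq0 subr_eq0 => /eqP.
move=> i j; have /connectP[p] := conn i j.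
elim: p i => [|k p IH] i /=; first by move=> _ ->.
by case/andP=> /edge-> /IH.
Qed.

(** Restricted to vectors supported on the inverters, the Laplacian form is
    still nonnegative, and the gains add [- K > 0]. *)
Lemma inverter_block_coercive (R : realFieldType) (n m : nat)
    (e : rel 'I_(n + m)) (B : 'M[R]_(n + m)) (K : 'cV[R]_m) :
  susceptance_matrix e B -> (forall i, K i 0 < 0) ->
  exists2 k : R, 0 < k & coercive k (- (drsubmx B + dg K)).
Proof.
move=> hB hK.
have [k k0 kK] : exists2 k : R, 0 < k & forall i, k <= - K i 0.
  by apply: exists_pos_lower_bound => i; rewrite oppr_gt0.
exists k => // y.
have : 0 <= sdot y (- drsubmx B *m y).
  have := laplacian_ge0 (col_mx 0 y) hB.
  rewrite -{1}(submxK B) opp_block_mx mul_block_col !mulmx0 !add0r sdot_col.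
  by rewrite sdotC sdot0r add0r.
rewrite opprD mulmxDl sdotDr; set l := sdot y _ => l0.
apply: (@le_trans _ _ (sdot y (- dg K *m y))); last by rewrite lerDr.
rewrite mulr_sumr; apply: ler_sum => i _.
rewrite mulNmx mxE mul_dgE; have := kK i; have := sqr_ge0 (y i 0); nra.
Qed.

Lemma inverter_block_unit (R : realFieldType) (n m : nat)
    (e : rel 'I_(n + m)) (B : 'M[R]_(n + m)) (K : 'cV[R]_m) :
  susceptance_matrix e B -> (forall i, K i 0 < 0) ->
  drsubmx B + dg K \in unitmx.
Proof.
move=> hB hK; have [k k0 ck] := inverter_block_coercive hB hK.
by rewrite -unitmxN (coercive_unit k0 ck).
Qed.

(** Completing the square: for [d = (u, w)] and [z = w + Hd^-1 Hdl u], the form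
    of [H] at [d] is that of the Schur complement at [u] plus that of [Hd] at
    [z]. *)
Lemma schur_coercive (R : realType) (n m : nat) (H : 'M[R]_(n + m))
    (a k : R) :
  H^T = H -> 0 < a -> 0 < k -> coercive k (drsubmx H) ->
  coercive a (ulsubmx H - ursubmx H *m invmx (drsubmx H) *m dlsubmx H) ->
  exists2 mu : R, 0 < mu & coercive mu H.
Proof.
move=> symH a0 k0 ck ca.
set S := invmx (drsubmx H) *m dlsubmx H.
have dunit := coercive_unit k0 ck.
have [C C0 SC] := mulmx_bounded S.
pose s : R := m%:R * C ^+ 2.
have s0 : 0 <= s by rewrite mulr_ge0 ?sqr_ge0.
have Ss u : sdot (S *m u) (S *m u) <= s * sdot u u.
  apply: (@le_trans _ _ (m%:R * (C * `|u|) ^+ 2)).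
    rewrite (le_trans (ler_norm _)) // (le_trans (sdot_le_norm _ _)) //.
    by rewrite ler_wpM2l // expr2 ler_pM.
  by rewrite exprMn mulrA ler_wpM2l // sqr_norm_le.
(* w = z - S u gives |w|^2 <= 2 |z|^2 + 2 s |u|^2; the two entries of the
   minimum absorb the coefficients of |u|^2 and |z|^2 *)
pose mu := Num.min (a / (1 + 2 * s)) (k / 2).
have mu0 : 0 < mu by rewrite lt_min !divr_gt0 //; lra.
have mua : mu * (1 + 2 * s) <= a by rewrite -ler_pdivlMr ?ge_min ?lexx //; lra.
have muk : mu * 2 <= k by rewrite -ler_pdivlMr ?ge_min ?lexx ?orbT.
exists mu => // d; rewrite -(vsubmxK d).
set u := usubmx d; set w := dsubmx d; pose z := w + S *m u.
have dlT : (dlsubmx H)^T = ursubmx H by rewrite trmx_dlsub symH.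
have drT : (drsubmx H)^T = drsubmx H by rewrite trmx_drsub symH.
have dS : drsubmx H *m S = dlsubmx H by rewrite mulKVmx.
have urS : ursubmx H *m z =
    ursubmx H *m w + ursubmx H *m invmx (drsubmx H) *m dlsubmx H *m u.
  by rewrite mulmxDr /S !mulmxA.
have formE : sdot (col_mx u w) (H *m col_mx u w) =
    sdot u ((ulsubmx H - ursubmx H *m invmx (drsubmx H) *m dlsubmx H) *m u) +
    sdot z (drsubmx H *m z).
  rewrite -{1}(submxK H) mul_block_col sdot_col mulmxBl.
  have -> : sdot z (drsubmx H *m z) =
      sdot w (drsubmx H *m z) + sdot u (ursubmx H *m z).
    rewrite {1}/z sdotDl; congr (_ + _).
    by rewrite sdot_mul drT mulmxA dS [RHS]sdot_mul -dlT trmxK.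
  have -> : drsubmx H *m z = dlsubmx H *m u + drsubmx H *m w.
    by rewrite mulmxDr mulmxA dS addrC.
  rewrite urS !sdotDr sdotNr; ring.
rewrite formE sdot_col.
have w2 : sdot w w <= 2 * sdot z z + 2 * (s * sdot u u).
  apply: (@le_trans _ _ (2 * sdot z z + 2 * sdot (S *m u) (S *m u))).
    have -> : w = z - S *m u by rewrite addrK.
    rewrite /sdot !mulr_sumr -big_split /=; apply: ler_sum => i _.
    set p := (S *m u) i 0; rewrite mxE [X in _ + X]mxE -/p.
    have := sqr_ge0 (z i 0 + p); nra.
  by rewrite lerD2l ler_pM2l.
have := ca u; have := ck z; have := sdot_ge0 u; have := sdot_ge0 z.
move: (sdot z z) (sdot u u) (sdot w w) w2 => zz uu ww w2 z0 u0.
set f := sdot z _; set g := sdot u _ => kz au.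
apply: (@le_trans _ _ (a * uu + k * zz)); last by lra.
have := ler_wpM2l (ltW mu0) w2.
have := ler_wpM2r u0 mua; have := ler_wpM2r z0 muk; lra.
Qed.

Lemma augmented_schur (R : comUnitRingType) (n m : nat) (B : 'M[R]_(n + m))
    (b : 'cV[R]_n) (K : 'cV[R]_m) : drsubmx B + dg K \in unitmx ->
  let H := augmented B b K in
  ulsubmx H - ursubmx H *m invmx (drsubmx H) *m dlsubmx H
  = - (Bred B K + dg b).
Proof.
move=> uM; rewrite /= augmentedE.
rewrite block_mxKul block_mxKur block_mxKdl block_mxKdr invmxN // /Bred.
by rewrite !(mulmxN, mulNmx) !opprK !opprD !opprK addrAC.
Qed.

Lemma tr_augmented (R : comPzRingType) (n m : nat) (B : 'M[R]_(n + m))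
    (b : 'cV[R]_n) (K : 'cV[R]_m) :
  (forall i j, B i j = B j i) -> (augmented B b K)^T = augmented B b K.
Proof.
move=> symB; rewrite /augmented linearN linearD /= tr_dg.
by congr (- (_ + _)); apply/matrixP => i j; rewrite mxE.
Qed.

Lemma tr_Bred (R : comUnitRingType) (n m : nat) (B : 'M[R]_(n + m))
    (K : 'cV[R]_m) : (forall i j, B i j = B j i) -> (Bred B K)^T = Bred B K.
Proof.
move=> symB; have BT : B^T = B by apply/matrixP => i j; rewrite mxE.
rewrite /Bred linearB /= !trmx_mul trmx_inv linearD /= tr_dg.
by rewrite trmx_ulsub trmx_ursub trmx_dlsub trmx_drsub BT mulmxA.
Qed.

(** A vector killed by [Bred] extends to one killed by [B + diag(0, K)]; its
    Laplacian form and its inverter part vanish, and connectedness spreads the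
    zero from an inverter to every bus. *)
Lemma Bred_unit (R : realFieldType) (n m : nat) (e : rel 'I_(n + m))
    (B : 'M[R]_(n + m)) (K : 'cV[R]_m) :
  (0 < m)%N -> connected_graph e -> susceptance_matrix e B ->
  (forall i, K i 0 < 0) -> Bred B K \in unitmx.
Proof.
move=> m0 conn hB hK; apply: mulmx_inj_unit => x Bx.
have uM := inverter_block_unit hB hK.
pose y := - (invmx (drsubmx B + dg K) *m dlsubmx B *m x).
have Bz : - B *m col_mx x y = col_mx 0 (dg K *m y).
  rewrite -{1}(submxK B) mulNmx mul_block_col opp_col_mx.
  congr col_mx.
    rewrite -[RHS]oppr0 -[in RHS]Bx /Bred mulmxBl /y mulmxN !mulmxA.
    by [].
  have -> : dlsubmx B *m x = - ((drsubmx B + dg K) *m y).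
    by rewrite mulmxN opprK -mulmxA mulKVmx.
  rewrite mulmxDl -[RHS]opprK; congr (- _).
  by rewrite opprD addrAC addNr add0r.
have yK : 0 <= sdot y (dg K *m y).
  have := laplacian_ge0 (col_mx x y) hB.
  by rewrite Bz sdot_col sdot0r add0r.
have termK i : 0 <= - (y i 0 * (dg K *m y) i 0).
  rewrite mul_dgE mulrCA -mulNr mulr_ge0 // ?oppr_ge0 ?(ltW (hK i)) //.
  by rewrite -expr2 sqr_ge0.
have y0 i : y i 0 = 0.
  have : \sum_i - (y i 0 * (dg K *m y) i 0) == 0.
    by rewrite eq_le sumr_ge0 // andbT sumrN oppr_le0.
  rewrite psumr_eq0 // => /allP /(_ i (mem_index_enum _)) /=.
  rewrite mul_dgE oppr_eq0 !mulf_eq0 (lt_eqF (hK i)) /=.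
  by rewrite orbb => /eqP.
have const := @laplacian_kernel _ _ _ _ (col_mx x y) conn hB.
apply/colP => i; rewrite mxE -(col_mxEu x y).
rewrite (const _ _ (rshift n (Ordinal m0))).
  by rewrite col_mxEd.
by rewrite Bz sdot_col sdot0r add0r; apply: sumr_le0 => j _; rewrite y0 mul0r.
Qed.

(** * Load equations with a truncated constant-power term *)

Lemma le0_geometric (R : realType) (a C : R) :
  (forall k, a <= C / 2 ^+ k) -> a <= 0.
Proof.
move=> h; rewrite leNgt; apply/negP => a0.
have C0 : 0 <= C by have := h 0%N; rewrite expr0 divr1; lra.
have := h (Num.bound (C / a)); apply/negP; rewrite -ltNge.
rewrite ltr_pdivrMr ?exprn_gt0 // mulrC -ltr_pdivrMr //.
have C1 : 0 <= C / a by rewrite divr_ge0 // ltW.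
apply: (lt_le_trans (archi_boundP C1)).
by rewrite -natrX ler_nat ltnW // ltn_expl.
Qed.

(** The intervals of centre [u k] and radius [2 C / 2 ^ k] are nested. *)
Lemma geometric_limit_real (R : realType) (u : nat -> R) (C : R) :
  (forall k, `|u k.+1 - u k| <= C / 2 ^+ k) ->
  exists l, forall k, `|l - u k| <= 2 * C / 2 ^+ k.
Proof.
move=> hu; pose d k := 2 * C / 2 ^+ k.
have dS k : d k = d k.+1 + C / 2 ^+ k.
  by rewrite /d exprS; field; rewrite expf_neq0.
have C0 k : 0 <= C / 2 ^+ k := le_trans (normr_ge0 _) (hu k).
have d0 k : 0 <= d k by rewrite /d -mulrA mulr_ge0.
have vS k : u k - d k <= u k.+1 - d k.+1.
  have := hu k; rewrite (dS k) ler_norml => /andP[].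
  move: (C / 2 ^+ k) (d k.+1) => p r; lra.
have wS k : u k.+1 + d k.+1 <= u k + d k.
  have := hu k; rewrite (dS k) ler_norml => /andP[].
  move: (C / 2 ^+ k) (d k.+1) => p r; lra.
have v_nd k p : u k - d k <= u (k + p)%N - d (k + p)%N.
  by elim: p => [|p IH]; [rewrite addn0|rewrite addnS (le_trans IH)].
have w_ni k p : u (k + p)%N + d (k + p)%N <= u k + d k.
  by elim: p => [|p IH]; [rewrite addn0|rewrite addnS (le_trans _ IH)].
have vw i j : u i - d i <= u j + d j.
  apply: (le_trans (v_nd i j)); apply: le_trans (w_ni j i).
  rewrite [(j + i)%N]addnC; have := d0 (i + j)%N; lra.
pose E := range (fun k => u k - d k).
have supE : has_sup E.
  split; first by exists (u 0%N - d 0%N), 0%N.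
  by exists (u 0%N + d 0%N) => _ [k _ <-].
exists (sup E) => k; rewrite -/(d k) ler_distl; apply/andP; split.
  by apply: sup_upper_bound => //; exists k.
by apply: ge_sup => [|_ [j _ <-]]; [case: supE|exact: vw].
Qed.

Lemma geometric_limit (R : realType) (n : nat) (u : nat -> 'cV[R]_n) (C : R) :
  (forall k, `|u k.+1 - u k| <= C / 2 ^+ k) ->
  exists l, forall k, `|l - u k| <= 2 * C / 2 ^+ k.
Proof.
move=> hu; have C0 k : 0 <= C / 2 ^+ k := le_trans (normr_ge0 _) (hu k).
have lim i : exists l, forall k, `|l - u k i 0| <= 2 * C / 2 ^+ k.
  apply: geometric_limit_real => k; apply: le_trans (hu k).
  by have := norm_coord (u k.+1 - u k) i 0; rewrite !mxE.
have [l hl] := choice lim.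
exists (\col_i l i) => k; apply: cvnorm_le => [|i]; last by rewrite !mxE.
by rewrite -mulrA mulr_ge0.
Qed.

Lemma contraction_fixpoint (R : realType) (n : nat)
    (f : 'cV[R]_n -> 'cV[R]_n) :
  (forall x y, `|f x - f y| <= 2^-1 * `|x - y|) -> exists x, f x = x.
Proof.
move=> cf; pose u k := iter k f 0.
have hu k : `|u k.+1 - u k| <= `|f 0| / 2 ^+ k.
  elim: k => [|k IH]; first by rewrite /u /= subr0 expr0 divr1.
  by rewrite (le_trans (cf _ _)) // exprS invfM mulrCA ler_wpM2l // invr_ge0.
have [l hl] := geometric_limit hu.
exists l; apply/eqP; rewrite -subr_eq0 -normr_le0.
apply: (@le0_geometric _ _ (4 * `|f 0|)) => k.
have -> : f l - l = (f l - f (u k)) - (l - u k.+1) by rewrite opprB addrA subrK.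
rewrite (le_trans (ler_normB _ _)) //.
have h1 : `|f l - f (u k)| <= 2^-1 * (2 * `|f 0| / 2 ^+ k).
  by rewrite (le_trans (cf _ _)) // ler_wpM2l // invr_ge0.
apply: le_trans (lerD h1 (hl k.+1)) _.
have : 0 <= `|f 0| / 2 ^+ k by rewrite divr_ge0 // exprn_ge0.
by rewrite exprS invfM; lra.
Qed.

(** Replacing [x_i] by [max (x_i, eps)] in the currents [q_i / x_i] drawn by
    constant-power loads makes them globally Lipschitz. *)
Definition trunc_current (R : realType) (n : nat) (eps : R) (q x : 'cV[R]_n) :
    'cV[R]_n :=
  \col_i (q i 0 / Num.max (x i 0) eps).

Lemma trunc_current_lip_coord (R : realType) (n : nat) (eps : R)
    (q x y : 'cV[R]_n) i : 0 < eps ->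
  `|(trunc_current eps q x - trunc_current eps q y) i 0|
  <= `|q| / eps ^+ 2 * `|(x - y) i 0|.
Proof.
move=> e0; rewrite !mxE -mulrBr normrM -mulrA ler_pM ?norm_coord //.
set a := x i 0; set b := y i 0.
have maxge c : eps <= Num.max c eps by rewrite le_max lexx orbT.
have maxlip : `|Num.max b eps - Num.max a eps| <= `|a - b|.
  rewrite distrC; case: (leP a eps) => ha; case: (leP b eps) => hb.
  - by rewrite subrr normr0.
  - by rewrite distrC (distrC a) ger0_norm ?ger0_norm; lra.
  - by rewrite ger0_norm ?ger0_norm; lra.
  - by [].
move: (maxge a) (maxge b) maxlip; set p := Num.max a _; set r := Num.max b _.
move=> pe re pr.
have p0 : 0 < p := lt_le_trans e0 pe.
have r0 : 0 < r := lt_le_trans e0 re.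
have -> : p^-1 - r^-1 = (r - p) / (p * r) by field; rewrite !gt_eqF.
rewrite normrM mulrC ler_pM // normfV gtr0_norm ?mulr_gt0 //.
by rewrite lef_pV2 ?posrE ?mulr_gt0 ?exprn_gt0 // expr2 ler_pM // ltW.
Qed.

Lemma trunc_current_lip (R : realType) (n : nat) (eps : R)
    (q x y : 'cV[R]_n) : 0 < eps ->
  `|trunc_current eps q x - trunc_current eps q y|
  <= `|q| / eps ^+ 2 * `|x - y|.
Proof.
move=> e0; have c0 : 0 <= `|q| / eps ^+ 2 by rewrite divr_ge0 ?sqr_ge0.
apply: cvnorm_le => [|i]; first by rewrite mulr_ge0.
rewrite (le_trans (trunc_current_lip_coord _ _ _ _ e0)) //.
by rewrite ler_wpM2l ?norm_coord.
Qed.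

Lemma sdot_trunc_current (R : realType) (n : nat) (eps : R)
    (q x y : 'cV[R]_n) : 0 < eps ->
  sdot (x - y) (trunc_current eps q x - trunc_current eps q y)
  <= `|q| / eps ^+ 2 * sdot (x - y) (x - y).
Proof.
move=> e0; rewrite mulr_sumr; apply: ler_sum => i _.
rewrite (le_trans (ler_norm _)) // normrM.
have -> : (x - y) i 0 * (x - y) i 0 = `|(x - y) i 0| * `|(x - y) i 0|.
  by rewrite -!expr2 real_normK ?num_real.
by rewrite mulrCA ler_wpM2l // trunc_current_lip_coord.
Qed.

Lemma trunc_current_norm (R : realType) (n : nat) (eps : R)
    (q x : 'cV[R]_n) : 0 < eps -> `|trunc_current eps q x| <= `|q| / eps.
Proof.
move=> e0; apply: cvnorm_le => [|i]; first by rewrite divr_ge0 // ltW.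
rewrite mxE normrM ler_pM ?norm_coord // normfV.
have me : eps <= Num.max (x i 0) eps by rewrite le_max lexx orbT.
have m0 := lt_le_trans e0 me.
by rewrite gtr0_norm // lef_pV2.
Qed.

(** Multiplied by [x_i > eps], the truncated current balance is the power
    balance. *)
Lemma trunc_current_eq (R : realType) (n : nat) (eps : R)
    (q x z : 'cV[R]_n) i : 0 < eps -> eps < x i 0 ->
  (x i 0 * z i 0 = q i 0) <-> (z i 0 = trunc_current eps q x i 0).
Proof.
move=> e0 ex; rewrite mxE max_l ?(ltW ex) //.
have x0 : x i 0 != 0 by rewrite gt_eqF // (lt_trans e0).
by split=> [<-|->]; [rewrite mulrAC mulfV ?mul1r|rewrite mulrC divfK].
Qed.

(** The truncated currents contribute at most half of the difference of the two
    solutions, which is absorbed; [y = y'] gives uniqueness. *)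
Lemma trunc_solution_lip (R : realType) (n : nat) (A : 'M[R]_n) (a eps : R)
    (q x x' y y' : 'cV[R]_n) :
  A \in unitmx -> 0 < eps ->
  (forall z : 'cV[R]_n, `|invmx A *m z| <= a * `|z|) ->
  a * (`|q| / eps ^+ 2) <= 2^-1 -> 0 <= a ->
  A *m x = y + trunc_current eps q x ->
  A *m x' = y' + trunc_current eps q x' ->
  `|x - x'| <= 2 * a * `|y - y'|.
Proof.
move=> uA e0 hA small a0 hx hx'.
have xE : x - x' = invmx A *m ((y - y') +
    (trunc_current eps q x - trunc_current eps q x')).
  by rewrite addrACA -opprD -hx -hx' mulmxBr !mulKmx.
have h1 : `|x - x'| <= a * `|y - y'| +
    a * `|trunc_current eps q x - trunc_current eps q x'|.
  by rewrite {1}xE -mulrDr (le_trans (hA _)) // ler_wpM2l // ler_normD.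
have h2 : a * `|trunc_current eps q x - trunc_current eps q x'|
    <= 2^-1 * `|x - x'|.
  apply: le_trans (ler_wpM2r (normr_ge0 _) small).
  by rewrite -mulrA ler_wpM2l // trunc_current_lip.
lra.
Qed.

(** [x |-> A^-1 (y + trunc_current eps q x)] is a contraction of factor
    [1 / 2]. *)
Lemma trunc_solution_exists (R : realType) (n : nat) (A : 'M[R]_n) (a eps : R)
    (q y : 'cV[R]_n) :
  A \in unitmx -> 0 < eps ->
  (forall z : 'cV[R]_n, `|invmx A *m z| <= a * `|z|) ->
  a * (`|q| / eps ^+ 2) <= 2^-1 -> 0 <= a ->
  exists x, A *m x = y + trunc_current eps q x.
Proof.
move=> uA e0 hA small a0.
have [|x hx] :=
  @contraction_fixpoint R n (fun x => invmx A *m (y + trunc_current eps q x)).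
  move=> x x'; rewrite -mulmxBr opprD addrACA subrr add0r.
  apply: le_trans (ler_wpM2r (normr_ge0 _) small).
  by rewrite (le_trans (hA _)) // -mulrA ler_wpM2l // trunc_current_lip.
by exists x; rewrite -{1}hx mulKVmx.
Qed.

(** * Initial value problems with a Lipschitz right-hand side *)

Lemma is_derive_cst1 (R : realType) (c t : R) : is_derive t 1 (fun=> c) 0.
Proof. exact: is_derive_cst. Qed.

Lemma is_derive_continuous (R : realType) (f : R -> R) (t d : R) :
  is_derive t 1 f d -> {for t, continuous f}.
Proof.
move=> fd; apply: differentiable_continuous; apply/derivable1_diffP.
exact: ex_derive.
Qed.

Lemma is_derive_expRM (R : realType) (c t : R) :
  is_derive t 1 (fun s => expR (c * s)) (c * expR (c * t)).
Proof.
have h : is_derive t 1 ( *%R c : R -> R) c.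
  have := is_deriveZ c (is_derive_id t (1 : R)); rewrite /GRing.scale /= mulr1.
  by apply.
by rewrite mulrC; apply: (is_derive1_comp (f := expR)).
Qed.

Lemma derive_ge0_le (R : realType) (f df : R -> R) (a b : R) :
  a <= b -> (forall t : R, a < t -> t < b -> is_derive t 1 f (df t)) ->
  {within `[a, b], continuous f} ->
  (forall t : R, a < t -> t < b -> 0 <= df t) -> f a <= f b.
Proof.
rewrite le_eqVlt => /orP[/eqP -> //|ab] fd fc df0.
have [|c] := @MVT _ f df _ _ ab _ fc.
  by move=> x; rewrite in_itv => /andP[]; exact: fd.
rewrite in_itv /= => /andP[ac cb] fE.
by rewrite -subr_ge0 fE mulr_ge0 ?df0 // subr_ge0 ltW.
Qed.

(** [f t * expR (- k t)] is nonincreasing. *)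
Lemma gronwall (R : realType) (f df : R -> R) (a b k : R) :
  a <= b -> (forall t : R, a < t -> t < b -> is_derive t 1 f (df t)) ->
  {within `[a, b], continuous f} ->
  (forall t : R, a < t -> t < b -> df t <= k * f t) ->
  f b <= f a * expR (k * (b - a)).
Proof.
move=> ab fd fc dfk.
pose g : R -> R := - (f * (fun s => expR (- k * s))).
pose dg (t : R) : R :=
  - (f t *: (- k * expR (- k * t)) + expR (- k * t) *: df t).
have : g a <= g b.
  apply: (@derive_ge0_le _ g dg) => // [t at_ tb||t at_ tb].
  - apply: is_deriveN; apply: is_deriveM; first exact: fd.
    exact: is_derive_expRM.
  - move=> t; apply: cvgN; apply: cvgM; first exact: fc.
    apply: (continuous_subspaceT (f := fun s => expR (- k * s))) => s.
    exact: is_derive_continuous (is_derive_expRM (- k) s).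
  - rewrite /dg /GRing.scale /=; have := dfk t at_ tb.
    have := expR_gt0 (- k * t); nra.
rewrite /g -[X in X <= _ -> _]/(- (f a * expR (- k * a))).
rewrite -[X in _ <= X -> _]/(- (f b * expR (- k * b))) lerN2 => le.
have -> : f b = f b * expR (- k * b) * expR (k * b).
  by rewrite -mulrA -expRD mulNr addNr expR0 mulr1.
have -> : k * (b - a) = - k * a + k * b by ring.
by rewrite expRD mulrA ler_wpM2r // expR_ge0.
Qed.

(** The integral starts at [-1] so that [0] is interior to the domain of the
    primitive. *)
Lemma primitive_exists (R : realType) (f : R -> R) (c : R) : continuous f ->
  exists2 P : R -> R, P 0 = c & forall t : R, -1 < t -> is_derive t 1 P (f t).
Proof.
move=> fc.
pose F x := (\int[lebesgue_measure]_(t in [set` `[(-1 : R), x]]) (f t))%R.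
have Fd (t : R) : -1 < t -> is_derive t 1 F (f t).
  move=> t1; have [||||dF FE] := @continuous_FTC1_closed R f (-1) t (t + 1).
  - by rewrite ltrDl.
  - apply: continuous_compact_integrable; first exact: segment_compact.
    exact: continuous_subspaceT.
  - by [].
  - exact: fc.
  - by rewrite -FE derive1E; apply: DeriveDef.
exists (F + cst (c - F 0)).
  by rewrite -[LHS]/(F 0 + (c - F 0)) addrC subrK.
move=> t t1; rewrite -[f t]addr0; apply: is_deriveD; exact: Fd.
Qed.

(** [M expR (c t)] has derivative [c M expR (c t)], so it dominates any function
    that starts below it and grows no faster. *)
Lemma exp_comparison (R : realType) (f g df dg : R -> R) (c M : R) :
  (forall t : R, 0 <= t -> is_derive t 1 f (df t)) ->
  (forall t : R, 0 <= t -> is_derive t 1 g (dg t)) -> f 0 = g 0 -> 0 <= M ->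
  (forall t : R, 0 <= t -> `|df t - dg t| <= c * M * expR (c * t)) ->
  forall t : R, 0 <= t -> `|f t - g t| <= M * expR (c * t).
Proof.
move=> fd gd fg0 M0 hle.
suff le (u v du dv : R -> R) :
    (forall t : R, 0 <= t -> is_derive t 1 u (du t)) ->
    (forall t : R, 0 <= t -> is_derive t 1 v (dv t)) -> u 0 = v 0 ->
    (forall t : R, 0 <= t -> du t - dv t <= c * M * expR (c * t)) ->
    forall t : R, 0 <= t -> u t - v t <= M * expR (c * t).
  move=> t t0; rewrite ler_norml; apply/andP; split.
    rewrite lerNl opprB; apply: (le g f dg df) => // s s0.
    by rewrite (le_trans (ler_norm _)) // distrC hle.
  by apply: (le f g df dg) => // s s0; rewrite (le_trans (ler_norm _)) // hle.
move=> ud vd uv0 duv t t0.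
pose h : R -> R := M *: (fun s => expR (c * s)) - (u - v).
pose dh (s : R) : R := M *: (c * expR (c * s)) - (du s - dv s).
have hd (s : R) : 0 <= s -> is_derive s 1 h (dh s).
  move=> s0; apply: is_deriveB; last first.
    by apply: is_deriveB; [exact: ud|exact: vd].
  by apply: is_deriveZ; exact: is_derive_expRM.
have : h 0 <= h t.
  apply: (@derive_ge0_le _ h dh) => // [s s0 _||s s0 _].
  - by apply: hd; exact: ltW.
  - apply: derivable_within_continuous => s; rewrite in_itv /= => /andP[s0 _].
    by have fd0 := hd s s0; exact: ex_derive.
  - rewrite /dh /GRing.scale /= subr_ge0 (le_trans (duv _ (ltW s0))) //.
    by rewrite mulrCA mulrA.
rewrite -[X in X <= _ -> _]/(M * expR (c * 0) - (u 0 - v 0)).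
rewrite -[X in _ <= X -> _]/(M * expR (c * t) - (u t - v t)).
by rewrite uv0 subrr mulr0 expR0; lra.
Qed.

Lemma continuous_max0 (R : realType) : continuous (fun s : R => Num.max s 0).
Proof. by move=> s; apply: continuous_max; [exact: cvg_id|exact: cvg_cst]. Qed.

Lemma continuous_coordP (R : realType) (T : topologicalType) (m : nat)
    (y : T -> 'cV[R]_m) s :
  (forall i, {for s, continuous (fun t => y t i 0)}) -> {for s, continuous y}.
Proof.
move=> yc; apply/cvgrPdist_le => e e0.
have near_i i : \forall t \near s, `|y s i 0 - y t i 0| <= e.
  by have /cvgrPdist_le := yc i; apply.
have : \forall t \near s, forall i, `|y s i 0 - y t i 0| <= e.
  exact: filter_forall.
apply: filterS => t h; apply: cvnorm_le => [|i]; first exact: ltW.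
by have := h i; rewrite !mxE.
Qed.

Lemma lipschitz_continuous_comp (R : realType) (T : topologicalType)
    (m p : nat) (L : R) (G : 'cV[R]_m -> 'cV[R]_p) (y : T -> 'cV[R]_m) s :
  0 < L -> (forall x x', `|G x - G x'| <= L * `|x - x'|) ->
  {for s, continuous y} -> {for s, continuous (G \o y)}.
Proof.
move=> L0 GL yc; apply/cvgrPdist_le => e e0.
have /cvgrPdist_le /(_ (e / L)) := yc.
rewrite divr_gt0 // => /(_ isT); apply: filterS => t h.
by rewrite (le_trans (GL _ _)) // mulrC -ler_pdivlMr.
Qed.

Lemma continuous_coord (R : realType) (T : topologicalType) (m : nat)
    (y : T -> 'cV[R]_m) s i :
  {for s, continuous y} -> {for s, continuous (fun t => y t i 0)}.
Proof.
move=> yc; apply/cvgrPdist_le => e e0.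
have /cvgrPdist_le /(_ e e0) := yc; apply: filterS => t.
by apply: le_trans; have := norm_coord (y s - y t) i 0; rewrite !mxE.
Qed.

Lemma vector_exp_comparison (R : realType) (m : nat) (P Q p q : R -> 'cV[R]_m)
    (c M : R) :
  (forall (t : R) i, 0 <= t -> is_derive t 1 (fun s => P s i 0) (p t i 0)) ->
  (forall (t : R) i, 0 <= t -> is_derive t 1 (fun s => Q s i 0) (q t i 0)) ->
  P 0 = Q 0 -> 0 <= M ->
  (forall t : R, 0 <= t -> `|p t - q t| <= c * M * expR (c * t)) ->
  forall t : R, 0 <= t -> `|P t - Q t| <= M * expR (c * t).
Proof.
move=> Pd Qd PQ0 M0 pq t t0; apply: cvnorm_le => [|i].
  by rewrite mulr_ge0 ?expR_ge0.
rewrite !mxE; apply: (@exp_comparison _ (fun s => P s i 0) (fun s => Q s i 0)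
  (fun s => p s i 0) (fun s => q s i 0)) => //.
- by rewrite PQ0.
- move=> s s0; apply: le_trans (pq _ s0).
  by have := norm_coord (p s - q s) i 0; rewrite !mxE.
Qed.

(** Picard iteration: successive iterates differ by at most
    [C e^(2 L t) / 2 ^ k] on [t >= 0], because integrating [L e^(2 L t)] gains
    a factor [1 / 2]. Iterates are frozen on negative times, where no estimate
    is available. *)
Lemma ode_global_solution (R : realType) (m : nat) (L : R)
    (G : 'cV[R]_m -> 'cV[R]_m) (x0 : 'cV[R]_m) :
  0 < L -> (forall x x', `|G x - G x'| <= L * `|x - x'|) ->
  exists x : R -> 'cV[R]_m, x 0 = x0 /\
    forall (t : R) i, 0 <= t -> is_derive t 1 (fun s => x s i 0) (G (x t) i 0).
Proof.
move=> L0 GL; pose pos (s : R) := Num.max s 0.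
have posE t : 0 <= t -> pos t = t by move=> t0; rewrite /pos max_l.
have pos_ge0 s : 0 <= pos s by rewrite /pos le_max lexx orbT.
have step (y : R -> 'cV[R]_m) : exists P : R -> 'cV[R]_m, continuous y ->
    P 0 = x0 /\ forall (t : R) i, -1 < t ->
      is_derive t 1 (fun s => P s i 0) (G (y t) i 0).
  have [yc|] := pselect (continuous y); last by exists y.
  have prim i : exists P : R -> R, P 0 = x0 i 0 /\
      forall t : R, -1 < t -> is_derive t 1 P (G (y t) i 0).
    have [|P P0 Pd] := @primitive_exists R (fun t => G (y t) i 0) (x0 i 0).
      move=> s; apply: (@continuous_coord _ _ _ (G \o y) s i).
      exact: lipschitz_continuous_comp L0 GL (yc s).
    by exists P.
  have [P hP] := choice prim.
  exists (fun t => \col_i P i t) => _; split=> [|t i t1].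
    by apply/colP => i; rewrite mxE; have [] := hP i.
  have -> : (fun s => (\col_i P i s) i 0) = P i.
    by apply/funext => s; rewrite mxE.
  by have [_] := hP i; exact.
have [Phi hPhi] := choice step.
pose P := fix P k := if k is k'.+1 then Phi (P k' \o pos) else fun=> x0.
have Pc k : continuous (P k \o pos).
  elim: k => [|k IH] s; first exact: cvg_cst.
  have [_ d] := hPhi _ IH.
  apply: continuous_comp; first exact: continuous_max0.
  apply: continuous_coordP => i.
  have p1 : -1 < pos s by rewrite (lt_le_trans _ (pos_ge0 s)) // ltrN10.
  exact: is_derive_continuous (d _ i p1).
have P0 k : P k 0 = x0 by case: k => // k; have [] := hPhi _ (Pc k).
have PS (k : nat) (t : R) i : 0 <= t ->
    is_derive t 1 (fun s => P k.+1 s i 0) (G (P k t) i 0).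
  move=> t0; have [_ d] := hPhi _ (Pc k).
  have t1 : -1 < t by rewrite (lt_le_trans _ t0) // ltrN10.
  by have := d t i t1; rewrite /comp posE.
pose C := `|G x0| / (2 * L).
have C0 : 0 <= C by rewrite divr_ge0 // mulr_ge0 // ltW.
pose E t := expR (2 * L * t).
have E0 t : 0 <= E t := expR_ge0 _.
have diff k t : 0 <= t -> `|P k.+1 t - P k t| <= C * E t / 2 ^+ k.
  elim: k t => [|k IH] t t0.
    rewrite expr0 divr1.
    have d0 (s : R) i : 0 <= s ->
        is_derive s 1 (fun s' => P 0%N s' i 0) ((0 : 'cV[R]_m) i 0).
      by rewrite mxE => _; exact: is_derive_cst1.
    apply: (vector_exp_comparison (p := fun=> G x0) (q := fun=> 0) (PS 0%N) d0).
    - by rewrite !P0.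
    - exact: C0.
    - move=> s s0; rewrite subr0 mulrC {1}/C mulrC -mulrA.
      rewrite mulrA mulrCA divff ?mulr1 ?ler_peMr //; last first.
        by rewrite mulf_neq0 // gt_eqF.
      by rewrite -expR0 ler_expR !mulr_ge0 // ltW.
    - exact: t0.
  rewrite mulrAC.
  apply: (vector_exp_comparison (p := fun s => G (P k.+1 s))
    (q := fun s => G (P k s)) (PS k.+1) (PS k)).
  - by rewrite !P0.
  - by rewrite divr_ge0 ?exprn_ge0.
  - move=> s s0; rewrite (le_trans (GL _ _)) //.
    rewrite (le_trans (ler_wpM2l (ltW L0) (IH s s0))) //.
    rewrite /E exprS le_eqVlt; apply/orP; left; apply/eqP; field.
    by rewrite expf_neq0.
  - exact: t0.
have lim t : exists l, 0 <= t ->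
    forall k, `|l - P k t| <= 2 * (C * E t) / 2 ^+ k.
  have [t0|_] := leP 0 t; last by exists 0.
  have [l hl] := geometric_limit (u := fun k => P k t) (fun k => diff k t t0).
  by exists l.
have [y hy] := choice lim.
have yc : continuous (y \o pos).
  move=> s; apply/cvgrPdist_lt => e e0.
  pose D := 2 * (C * E (pos s + 1)).
  have [k hk] : exists k, D / 2 ^+ k < e / 3.
    apply: contrapT => /forallNP h; have : e / 3 <= 0.
      apply: (@le0_geometric _ _ D) => k.
      by rewrite leNgt; apply/negP; exact: h.
    by apply/negP; rewrite -ltNge divr_gt0.
  have bound s' : pos s' <= pos s + 1 -> `|y (pos s') - P k (pos s')| < e / 3.
    move=> le; apply: le_lt_trans hk; apply: le_trans (hy _ (pos_ge0 _) k) _.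
    rewrite ler_wpM2r ?invr_ge0 ?exprn_ge0 // ler_wpM2l // ler_wpM2l //.
    by rewrite ler_expR ler_wpM2l // mulr_ge0 // ltW.
  have posc : {for s, continuous pos} by exact: continuous_max0.
  near=> s'.
  have h1 : `|y (pos s) - P k (pos s)| < e / 3 by apply: bound; rewrite lerDl.
  have h2 : `|y (pos s') - P k (pos s')| < e / 3.
    apply: bound; rewrite -lerBlDl.
    apply: (le_trans (ler_norm _)); rewrite distrC.
    by near: s'; have /cvgrPdist_le := posc; apply.
  have h3 : `|P k (pos s) - P k (pos s')| < e / 3.
    near: s'; have /cvgrPdist_lt := Pc k s; apply; exact: divr_gt0.
  rewrite /=.
  have -> : y (pos s) - y (pos s') = (y (pos s) - P k (pos s)) +
      (P k (pos s) - P k (pos s')) - (y (pos s') - P k (pos s')).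
    by rewrite addrA subrK opprB addrA subrK.
  rewrite (le_lt_trans (ler_normB _ _)) //.
  have := ler_normD (y (pos s) - P k (pos s)) (P k (pos s) - P k (pos s')).
  lra.
have [X0 Xd] := hPhi _ yc.
set X := Phi _ in X0 Xd.
have XE t : 0 <= t -> X t = y t.
  move=> t0; apply/eqP; rewrite -subr_eq0 -normr_le0.
  apply: (@le0_geometric _ _ (2 * (C * E t))) => k.
  have h1 : `|X t - P k.+1 t| <= C / 2 ^+ k * E t.
    have Xd0 (s : R) i : 0 <= s ->
        is_derive s 1 (fun s' => X s' i 0) (G (y s) i 0).
      move=> s0; have s1 : -1 < s by rewrite (lt_le_trans _ s0) // ltrN10.
      by have := Xd s i s1; rewrite /comp posE.
    apply: (vector_exp_comparison (p := fun s => G (y s))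
      (q := fun s => G (P k s)) Xd0 (PS k)).
    - by rewrite X0 P0.
    - by rewrite divr_ge0 ?exprn_ge0.
    - move=> s s0; rewrite (le_trans (GL _ _)) //.
      rewrite (le_trans (ler_wpM2l (ltW L0) (hy s s0 k))) //.
      by rewrite le_eqVlt; apply/orP; left; apply/eqP; rewrite /E; ring.
    - exact: t0.
  have h2 := hy t t0 k.+1.
  have -> : X t - y t = (X t - P k.+1 t) - (y t - P k.+1 t).
    by rewrite opprB addrA subrK.
  rewrite (le_trans (ler_normB _ _)) // (le_trans (lerD h1 h2)) //.
  rewrite exprS le_eqVlt; apply/orP; left; apply/eqP; field.
  by rewrite expf_neq0.
exists X; split=> // t i t0; rewrite XE //.
have t1 : -1 < t by rewrite (lt_le_trans _ t0) // ltrN10.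
by have := Xd t i t1; rewrite /comp posE.
Unshelve. all: by end_near.
Qed.

(** * Solutions on the half-line *)

(** The supremum of the times up to which [P] holds would be a time at which
    [P] holds but beyond which it does not extend. *)
Lemma real_induction (R : realType) (P : R -> Prop) :
  P 0 ->
  (forall t, 0 <= t -> P t ->
    exists2 eta, 0 < eta & forall s, t < s -> s < t + eta -> P s) ->
  (forall t, 0 < t -> (forall s, 0 <= s -> s < t -> P s) -> P t) ->
  forall t, 0 <= t -> P t.
Proof.
move=> P0 Popen Pclosed t t0; apply: contrapT => nPt.
pose S := [set s : R | 0 <= s /\ forall r, 0 <= r -> r <= s -> P r].
have S0 : S 0.
  by split=> // r r0 r0'; have -> : r = 0 by apply/eqP; rewrite eq_le r0 r0'.
have supS : has_sup S.
  split; first by exists 0.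
  exists t => s [s0 hs]; rewrite leNgt; apply/negP => ts.
  by apply: nPt; apply: hs => //; exact: ltW.
have s0 : 0 <= sup S by exact: sup_upper_bound.
have below r : 0 <= r -> r < sup S -> P r.
  move=> r0 rS; have [|s [_ hs]] := @sup_adherent _ S (sup S - r) _ supS.
    by rewrite subr_gt0.
  by rewrite opprB addrC subrK => rs; apply: hs => //; exact: ltW.
have Psup : P (sup S).
  move: s0; rewrite le_eqVlt => /orP[/eqP <- //|s0].
  exact: Pclosed.
have [eta eta0 heta] := Popen _ s0 Psup.
have : sup S + eta / 2 <= sup S.
  apply: sup_upper_bound => //; split.
    by rewrite addr_ge0 // ltW ?divr_gt0.
  move=> r r0 rle; have [rS|rS|->//] := ltgtP r (sup S); first exact: below.
  by apply: heta => //; apply: le_lt_trans rle _; lra.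
lra.
Qed.

Lemma halfline_continuous_near (R : realType) (V : normedModType R) (y : R -> V)
    (t e : R) :
  {within `[0, +oo[, continuous y} -> 0 <= t -> 0 < e ->
  exists2 eta, 0 < eta &
    forall s, 0 <= s -> `|t - s| < eta -> `|y t - y s| < e.
Proof.
move=> yc t0 e0.
have yt : y x @[x --> within `[0, +oo[ (nbhs t)] --> y t.
  have /subspace_continuousP := yc; apply.
  by rewrite /= in_itv /= t0.
have /cvgrPdist_lt /(_ e e0) := yt.
rewrite near_withinE => /nbhs_ballP[eta /= eta0 heta].
exists eta => // s s0 ts; apply: heta => //.
by rewrite /= in_itv /= s0.
Qed.

Lemma halfline_derivative_coord (R : realType) (m : nat) (f : R -> 'cV[R]_m)
    (t : R) (v : 'cV[R]_m) :
  (forall i, is_derive t 1 (fun s => f s i 0) (v i 0)) ->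
  has_halfline_derivative f t v.
Proof.
move=> fd; rewrite /has_halfline_derivative; apply: cvg_within_filter.
apply/cvgrPdist_le => e e0.
have near_i i : \forall h \near (0 : R)^',
    `|v i 0 - h^-1 * (f (t + h) i 0 - f t i 0)| <= e.
  have [d dE] := fd i.
  have /cvgrPdist_le /(_ e e0) := d; rewrite /derive in dE; rewrite dE.
  apply: filterS => h; rewrite /GRing.scale /= mulr1.
  by rewrite [h + t]addrC.
have : \forall h \near (0 : R)^', forall i,
    `|v i 0 - h^-1 * (f (t + h) i 0 - f t i 0)| <= e.
  exact: filter_forall.
apply: filterS => h hi; apply: cvnorm_le => [|i]; first exact: ltW.
by have := hi i; rewrite !mxE.
Qed.

Lemma halfline_derivative_is_derive (R : realType) (m : nat)
    (f : R -> 'cV[R]_m) (t : R) (v : 'cV[R]_m) i :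
  0 < t -> has_halfline_derivative f t v ->
  is_derive t 1 (fun s => f s i 0) (v i 0).
Proof.
move=> t0 fv.
have lim : (fun h => h^-1 *: (((fun s => f s i 0) \o shift t) (h *: (1 : R))
    - f t i 0)) @ (0 : R)^' --> v i 0.
  apply/cvgrPdist_le => e e0.
  have /cvgrPdist_le /(_ e e0) := fv; rewrite near_withinE => near1.
  have near2 : \forall h \near (0 : R)^', 0 <= t + h.
    apply: nbhs_dnbhs; near=> h.
    have : `|0 - h| <= t by near: h; apply: cvgr_dist_le.
    by rewrite sub0r normrN ler_norml => /andP[]; lra.
  apply: filterS2 near1 near2 => h hP /hP h1.
  rewrite /GRing.scale /= mulr1 [h + t]addrC (le_trans _ h1) //.
  by have := norm_coord (v - h^-1 *: (f (t + h) - f t)) i 0; rewrite !mxE.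
split; first by apply/cvg_ex; exists (v i 0).
exact/cvg_lim.
Unshelve. all: by end_near.
Qed.

(** As long as [V < rho], the bound [V' <= - lam V] holds and keeps [V] below
    its initial value, hence below [rho] for ever. *)
Lemma barrier_decay (R : realType) (V dV : R -> R) (rho lam : R) :
  (forall t : R, 0 <= t -> is_derive t 1 V (dV t)) ->
  (forall t, 0 <= t -> 0 <= V t) -> 0 < lam -> V 0 < rho ->
  (forall t, 0 <= t -> V t < rho -> dV t <= - lam * V t) ->
  forall t, 0 <= t -> V t < rho /\ V t <= V 0 * expR (- lam * t).
Proof.
move=> Vd V0 lam0 Vrho dVle.
have Vc t : {within `[0, t], continuous V}.
  apply: derivable_within_continuous => s; rewrite in_itv /= => /andP[s0 _].
  by have d := Vd s s0; exact: ex_derive.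
have decay t : 0 <= t -> (forall s, 0 <= s -> s < t -> V s < rho) ->
    V t <= V 0 * expR (- lam * t).
  move=> t0 below; rewrite -[X in expR (_ * X)]subr0.
  apply: (@gronwall _ V dV) => // [s s0 _|s s0 st]; first exact: Vd (ltW s0).
  by apply: dVle; [exact: ltW|apply: below => //; exact: ltW].
have stay t : 0 <= t -> V t < rho.
  move: t; apply: (real_induction (P := fun t => V t < rho)) => //.
    move=> t t0 Vt; have /cvgrPdist_lt /(_ (rho - V t)) :=
      is_derive_continuous (Vd t t0).
    rewrite subr_gt0 => /(_ Vt) /nbhs_ballP[eta /= eta0 h].
    exists eta => // s ts st; have /h : ball t eta s.
      by rewrite /ball /= distrC gtr0_norm ?subr_gt0 // ltrBlDl.
    by rewrite distrC; have := ler_norm (V s - V t); lra.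
  move=> t t0 below; apply: le_lt_trans Vrho.
  rewrite (le_trans (decay _ (ltW t0) below)) // ler_piMr ?V0 //.
  by rewrite -expR0 ler_expR mulNr oppr_le0 mulr_ge0 // ltW.
move=> t t0; split; first exact: stay.
by apply: decay => // s s0 _; exact: stay.
Qed.

(** Gronwall's inequality for [|u - v|^2], which vanishes at [a]. *)
Lemma lipschitz_ode_unique (R : realType) (m : nat) (L : R)
    (G : 'cV[R]_m -> 'cV[R]_m) (u v : R -> 'cV[R]_m) (a b : R) :
  0 < L -> (forall x x', `|G x - G x'| <= L * `|x - x'|) -> a <= b ->
  {within `[a, b], continuous u} -> {within `[a, b], continuous v} ->
  (forall (t : R) i, a < t -> t < b ->
    is_derive t 1 (fun s => u s i 0) (G (u t) i 0)) ->
  (forall (t : R) i, a < t -> t < b ->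
    is_derive t 1 (fun s => v s i 0) (G (v t) i 0)) ->
  u a = v a -> u b = v b.
Proof.
move=> L0 GL ab uc vc ud vd uva.
pose w i : R -> R := (fun s => u s i 0) - (fun s => v s i 0).
pose f : R -> R := \sum_i w i * w i.
pose dw i (t : R) : R := G (u t) i 0 - G (v t) i 0.
pose df (t : R) : R := \sum_i (w i t *: dw i t + w i t *: dw i t).
have wE i t : w i t = (u t - v t) i 0 by rewrite !mxE.
have fE t : f t = sdot (u t - v t) (u t - v t).
  by rewrite /f fct_sumE; apply: eq_bigr => i _; rewrite -!wE.
have fd (t : R) : a < t -> t < b -> is_derive t 1 f (df t).
  move=> at_ tb; apply: is_derive_sum => i.
  have wd : is_derive t 1 (w i) (dw i t).
    by apply: is_deriveB; [exact: ud|exact: vd].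
  exact: is_deriveM.
have wc i : {within `[a, b], continuous (w i)}.
  move=> t; apply: cvgB.
    by apply: (@continuous_coord _ _ _ (u : subspace `[a, b] -> _)); exact: uc.
  by apply: (@continuous_coord _ _ _ (v : subspace `[a, b] -> _)); exact: vc.
have fc : {within `[a, b], continuous f}.
  apply: (big_ind (fun g : R -> R => {within `[a, b], continuous g})).
  - by move=> t; exact: cvg_cst.
  - by move=> g h gc hc t; apply: cvgD; [exact: gc|exact: hc].
  - by move=> i _ t; apply: cvgM; exact: wc.
have dfle (t : R) : a < t -> t < b -> df t <= 2 * (m%:R * L) * f t.
  move=> at_ tb.
  have -> : df t = 2 * sdot (u t - v t) (G (u t) - G (v t)).
    rewrite mulr_sumr; apply: eq_bigr => i _.
    have -> : (G (u t) - G (v t)) i 0 = dw i t by rewrite mxE mxE.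
    by rewrite -wE /GRing.scale /=; ring.
  rewrite -mulrA ler_pM2l // (le_trans (ler_norm _)) //.
  rewrite (le_trans (sdot_le_norm _ _)) // -mulrA ler_wpM2l //.
  rewrite fE (le_trans (ler_wpM2l (normr_ge0 _) (GL _ _))) //.
  by rewrite mulrCA ler_wpM2l ?(ltW L0) // -expr2 sqr_norm_le.
have := gronwall ab fd fc dfle; rewrite fE [f a]fE uva subrr sdot0r mul0r.
by move/sdot_eq0/eqP; rewrite subr_eq0 => /eqP.
Qed.

(** The coordinatewise retraction onto the box of centre [c] and radius [r]. *)
Definition clamp (R : realType) (m : nat) (c : 'cV[R]_m) (r : R)
    (z : 'cV[R]_m) : 'cV[R]_m :=
  \col_i Num.max (c i 0 - r) (Num.min (z i 0) (c i 0 + r)).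

Lemma clamp_id (R : realType) (m : nat) (c z : 'cV[R]_m) (r : R) :
  `|z - c| <= r -> clamp c r z = z.
Proof.
move=> zr; apply/colP => i; rewrite mxE.
have := le_trans (norm_coord (z - c) i 0) zr; rewrite !mxE ler_norml.
by move=> /andP[h1 h2]; rewrite min_l ?max_r //; lra.
Qed.

Lemma clamp_box (R : realType) (m : nat) (c z : 'cV[R]_m) (r : R) :
  0 <= r -> `|clamp c r z - c| <= r.
Proof.
move=> r0; apply: cvnorm_le => // i; rewrite !mxE ler_norml.
case: (leP (z i 0) (c i 0 + r)) => h; case: (leP (c i 0 - r) _) => h';
  apply/andP; split; lra.
Qed.

Lemma clamp_lip (R : realType) (m : nat) (c z z' : 'cV[R]_m) (r : R) :
  0 <= r -> `|clamp c r z - clamp c r z'| <= `|z - z'|.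
Proof.
move=> r0; apply: cvnorm_le => // i; rewrite !mxE.
have := norm_coord (z - z') i 0; rewrite !mxE; apply: le_trans.
move: (z i 0) (z' i 0) (c i 0) => x y d.
have := ler_norm (x - y); have := ler_norm (- (x - y)); rewrite normrN.
rewrite ler_norml => h1 h2.
have dr : d - r <= d + r by lra.
case: (leP x (d + r)) => hx; case: (leP y (d + r)) => hy;
  rewrite ?(max_r dr); case: (leP (d - r) x) => hx';
  case: (leP (d - r) y) => hy'; apply/andP; split; lra.
Qed.

(** * Exponential stability of the differential-algebraic system *)

(** The closed loop written in terms of the currents [J - H E]; see
    [closed_loop_rhsE]. *)
Definition zip_rhs (R : pzRingType) (n m : nat) (H : 'M[R]_(n + m))
    (J : 'cV[R]_(n + m)) (q : 'cV[R]_n) (E : 'cV[R]_(n + m)) :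
    'cV[R]_(n + m) :=
  dg E *m (J - H *m E) + col_mx q 0.

(** The current balance at the load buses, with truncated constant-power
    currents; [load_balance_zip_rhs] relates it to the algebraic equation. *)
Definition load_balance (R : realType) (n m : nat) (H : 'M[R]_(n + m))
    (J : 'cV[R]_(n + m)) (q : 'cV[R]_n) (eps : R) (E : 'cV[R]_(n + m)) : Prop :=
  usubmx (H *m E) = usubmx J + trunc_current eps q (usubmx E).

Lemma usubmx_zip_rhs (R : pzRingType) (n m : nat) (H : 'M[R]_(n + m)) J
    (q : 'cV[R]_n) E i :
  usubmx (zip_rhs H J q E) i 0
  = usubmx E i 0 * usubmx (J - H *m E) i 0 + q i 0.
Proof.
by rewrite mxE mxE mul_dgE col_mxEu [usubmx E i 0]mxE [usubmx _ i 0]mxE.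
Qed.

Lemma dsubmx_zip_rhs (R : pzRingType) (n m : nat) (H : 'M[R]_(n + m)) J
    (q : 'cV[R]_n) E i :
  dsubmx (zip_rhs H J q E) i 0 = dsubmx E i 0 * dsubmx (J - H *m E) i 0.
Proof.
rewrite mxE mxE mul_dgE col_mxEd [X in _ + X]mxE addr0.
by rewrite [dsubmx E i 0]mxE [dsubmx _ i 0]mxE.
Qed.

Lemma load_balance_zip_rhs (R : realType) (n m : nat) (H : 'M[R]_(n + m)) J
    (q : 'cV[R]_n) eps E : 0 < eps -> (forall i, eps < usubmx E i 0) ->
  0 = usubmx (zip_rhs H J q E) <-> load_balance H J q eps E.
Proof.
move=> e0 Ee.
have coordE i : usubmx (J - H *m E) i 0 =
    usubmx J i 0 - usubmx (H *m E) i 0 by rewrite linearB coordB.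
split=> [hE|hE].
  apply/colP => i; have := congr1 (fun M : 'cV_n => M i 0) hE.
  rewrite usubmx_zip_rhs [X in X = _]mxE coordE => h.
  have /(trunc_current_eq _ _ e0 (Ee i)) : usubmx E i 0 *
      (usubmx (H *m E) - usubmx J) i 0 = q i 0.
    rewrite coordB.
    apply/eqP; rewrite -subr_eq0 -oppr_eq0; apply/eqP; rewrite [RHS]h; ring.
  rewrite coordB => t.
  by rewrite [RHS]mxE -t addrC subrK.
apply/colP => i; rewrite usubmx_zip_rhs [LHS]mxE coordE.
have /(trunc_current_eq _ _ e0 (Ee i)) : (usubmx (H *m E) - usubmx J) i 0 =
    trunc_current eps q (usubmx E) i 0 by rewrite hE addrC addKr.
rewrite coordB => <-; ring.
Qed.

Lemma usubmx_mul_col (R : pzRingType) (n m : nat) (H : 'M[R]_(n + m))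
    (x : 'cV[R]_n) (z : 'cV[R]_m) :
  usubmx (H *m col_mx x z) = ulsubmx H *m x + ursubmx H *m z.
Proof. by rewrite -{1}(submxK H) mul_block_col col_mxKu. Qed.

(** For fixed inverter voltages [z], the load balance is a truncated equation
    with matrix [ulsubmx H] and a source that is affine in [z]. *)
Lemma load_map_exists (R : realType) (n m : nat) (H : 'M[R]_(n + m))
    (J : 'cV[R]_(n + m)) (q : 'cV[R]_n) (a eps : R) :
  ulsubmx H \in unitmx -> 0 < eps ->
  (forall z : 'cV[R]_n, `|invmx (ulsubmx H) *m z| <= a * `|z|) ->
  a * (`|q| / eps ^+ 2) <= 2^-1 -> 0 <= a ->
  exists (phi : 'cV[R]_m -> 'cV[R]_n) (C : R),
    [/\ 0 <= C, (forall z z', `|phi z - phi z'| <= C * `|z - z'|) &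
      forall x z, load_balance H J q eps (col_mx x z) <-> x = phi z].
Proof.
move=> uH e0 hH small a0.
pose src z := usubmx J - ursubmx H *m z.
have balE x z : load_balance H J q eps (col_mx x z) <->
    ulsubmx H *m x = src z + trunc_current eps q x.
  rewrite /load_balance usubmx_mul_col col_mxKu /src addrAC; split=> [<-|->].
    by rewrite addrK.
  by rewrite subrK.
have lip x x' y y' :=
  @trunc_solution_lip _ _ _ _ _ q x x' y y' uH e0 hH small a0.
have [phi phiE] :=
  choice (fun z => trunc_solution_exists (src z) uH e0 hH small a0).
have [C C0 hC] := mulmx_bounded (ursubmx H).
exists phi, (2 * a * C); split=> [|z z'|x z].
- by rewrite !mulr_ge0.
- rewrite (le_trans (lip _ _ _ _ (phiE z) (phiE z'))) // -[leRHS]mulrA.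
  rewrite ler_wpM2l ?mulr_ge0 //.
  have -> : src z - src z' = ursubmx H *m (z' - z).
    by rewrite mulmxBr /src; apply/colP => i; rewrite !coordB; ring.
  by rewrite (le_trans (hC _)) // distrC.
- rewrite balE; split=> [xE|->]; last exact: phiE.
  apply/eqP; rewrite -subr_eq0 -normr_le0.
  by rewrite (le_trans (lip _ _ _ _ xE (phiE z))) // subrr normr0 mulr0.
Qed.

(** Strong monotonicity of the reduced gradient: coercivity of [H] at the
    difference of two balanced states, the load part of the pairing being a
    difference of truncated currents, which is small. *)
Lemma load_balance_monotone (R : realType) (n m : nat) (H : 'M[R]_(n + m)) J
    (q : 'cV[R]_n) (eps mu : R) E E' :
  0 < eps -> 0 < mu -> coercive mu H -> `|q| / eps ^+ 2 <= mu / 2 ->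
  load_balance H J q eps E -> load_balance H J q eps E' ->
  mu / 2 * sdot (dsubmx (E - E')) (dsubmx (E - E'))
  <= sdot (dsubmx (E - E')) (dsubmx (H *m (E - E'))).
Proof.
move=> e0 mu0 cH small bE bE'.
have uE : usubmx (H *m (E - E')) =
    trunc_current eps q (usubmx E) - trunc_current eps q (usubmx E').
  by rewrite mulmxBr linearB /= bE bE' opprD addrACA subrr add0r.
have := cH (E - E'); rewrite -{1 2 3}(vsubmxK (E - E')) sdot_col.
rewrite -[X in _ <= sdot _ X]vsubmxK sdot_col uE.
rewrite [usubmx (E - E')]linearB /=.
have := sdot_trunc_current q (usubmx E) (usubmx E') e0.
have := sdot_ge0 (usubmx E - usubmx E').
have := sdot_ge0 (dsubmx (E - E')).
set p := sdot _ (trunc_current _ _ _ - _).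
set uu := sdot (usubmx E - _) _; set ww := sdot _ (dsubmx (H *m _)).
set dd := sdot (dsubmx _) _ => d0 u0 hp hc.
have := ler_wpM2r u0 small; have := mulr_ge0 (ltW mu0) u0.
have := mulr_ge0 (ltW mu0) d0; lra.
Qed.

(** The inverter dynamics once the load voltages are expressed through the
    inverter voltages; [g] is the reduced reactive current. *)
Definition reduced_field (R : realType) (m : nat) (tau : 'cV[R]_m)
    (g : 'cV[R]_m -> 'cV[R]_m) (z : 'cV[R]_m) : 'cV[R]_m :=
  \col_i (z i 0 * g z i 0 / tau i 0).

(** A product of Lipschitz functions is Lipschitz where its factors are
    bounded, here on the box. *)
Lemma reduced_field_clamp_lip (R : realType) (m : nat) (tau c : 'cV[R]_m)
    (g : 'cV[R]_m -> 'cV[R]_m) (Lg r : R) :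
  0 <= r -> 0 <= Lg -> (forall z z', `|g z - g z'| <= Lg * `|z - z'|) ->
  exists2 L : R, 0 < L & forall z z',
    `|reduced_field tau g (clamp c r z) - reduced_field tau g (clamp c r z')|
    <= L * `|z - z'|.
Proof.
move=> r0 Lg0 gL; pose k : 'cV[R]_m := \col_i (tau i 0)^-1.
pose Z := `|c| + r; pose Gb := `|g c| + Lg * r.
have Z0 : 0 <= Z by rewrite addr_ge0.
have Gb0 : 0 <= Gb by rewrite addr_ge0 // mulr_ge0.
have M0 : 0 <= (Z * Lg + Gb) * `|k| by rewrite mulr_ge0 // addr_ge0 // mulr_ge0.
exists ((Z * Lg + Gb) * `|k| + 1) => [|z z']; first by rewrite ltr_wpDl.
set w := clamp c r z; set w' := clamp c r z'.
have ww : `|w - w'| <= `|z - z'| by exact: clamp_lip.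
apply: (@le_trans _ _ ((Z * Lg + Gb) * `|k| * `|w - w'|)); last first.
  by rewrite ler_pM // lerDl.
apply: cvnorm_le => [|i]; first by rewrite mulr_ge0.
have -> : (reduced_field tau g w - reduced_field tau g w') i 0 =
    (w i 0 * (g w - g w') i 0 + (w - w') i 0 * g w' i 0) * k i 0.
  by rewrite !coordB !mxE; ring.
rewrite normrM mulrAC ler_pM ?norm_coord // mulrDl.
rewrite (le_trans (ler_normD _ _)) // !normrM lerD //.
  rewrite -mulrA ler_pM //; last first.
    by rewrite (le_trans (norm_coord _ _ _)).
  rewrite (le_trans (norm_coord _ _ _)) // -[w](subrK c) addrC.
  by rewrite (le_trans (ler_normD _ _)) // lerD2l clamp_box.
rewrite mulrC ler_pM ?norm_coord // (le_trans (norm_coord _ _ _)) //.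
rewrite -[g w'](subrK (g c)) addrC (le_trans (ler_normD _ _)) // lerD2l.
by rewrite (le_trans (gL _ _)) // ler_wpM2l // clamp_box.
Qed.

(** The weights [tau_i / (2 c_i)] make [V' = (z - c) . g + O(|z - c|^3)] for
    [V = \sum_i tau_i / (2 c_i) (z_i - c_i)^2]: dividing by [c_i] cancels the
    factor [z_i] of the dynamics up to first order. *)
Lemma reduced_decay (R : realType) (m : nat) (tau c : 'cV[R]_m)
    (g : 'cV[R]_m -> 'cV[R]_m) (Lg mu r0 : R) :
  pos_vec tau -> pos_vec c -> 0 <= Lg ->
  (forall z z', `|g z - g z'| <= Lg * `|z - z'|) -> g c = 0 -> 0 < mu ->
  (forall z, mu * sdot (z - c) (z - c) <= - sdot (z - c) (g z)) -> 0 < r0 ->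
  exists2 r, 0 < r <= r0 & exists delta C lam : R,
    [/\ 0 < delta, 0 < C, 0 < lam & forall z : R -> 'cV[R]_m,
      (forall (t : R) i, 0 <= t -> is_derive t 1 (fun s => z s i 0)
        (reduced_field tau g (clamp c r (z t)) i 0)) ->
      `|z 0 - c| < delta -> forall t, 0 <= t ->
      `|z t - c| < r /\ `|z t - c| <= C * expR (- lam * t) * `|z 0 - c|].
Proof.
move=> tau0 c0 Lg0 gL gc mu0 mono r00.
pose ci : 'cV[R]_m := \col_i (c i 0)^-1.
pose k : 'cV[R]_m := \col_i (tau i 0 / (2 * c i 0)).
have k0 i : 0 < k i 0 by rewrite mxE divr_gt0 ?mulr_gt0.
have [kmin kmin0 kminE] := exists_pos_lower_bound k0.
pose kmax := `|k| + 1.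
have kmax0 : 0 < kmax by rewrite ltr_wpDl.
have kmaxE i : k i 0 <= kmax.
  by rewrite (le_trans (ler_norm _)) // (le_trans (norm_coord _ _ _)) // lerDl.
(* the second bound makes the cubic remainder of V' at most half of the
   quadratic term *)
pose r := Num.min r0 (mu / (2 * (Lg * `|ci| + 1))).
have D0 : 0 < Lg * `|ci| + 1 by rewrite ltr_wpDl // mulr_ge0.
have rgt0 : 0 < r by rewrite lt_min r00 divr_gt0 // mulr_gt0.
have rr0 : r <= r0 by rewrite ge_min lexx.
have rmu : r * (Lg * `|ci|) <= mu / 2.
  have : r <= mu / (2 * (Lg * `|ci| + 1)) by rewrite ge_min lexx orbT.
  rewrite ler_pdivlMr ?mulr_gt0 //; lra.
exists r; first by rewrite rgt0.
pose lam := mu / (2 * kmax).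
have lam0 : 0 < lam by rewrite divr_gt0 // mulr_gt0.
pose K := kmax * m%:R.
have K0 : 0 <= K by rewrite mulr_ge0 // ltW.
(* |z 0 - c| < r s puts V 0 below kmin r^2, a level whose sublevel set lies in
   the box on which the clamp is the identity *)
pose s := Num.min 1 (kmin / (K + 1)).
have s0 : 0 < s by rewrite lt_min ltr01 divr_gt0 // ltr_wpDl.
have s1 : s <= 1 by rewrite ge_min lexx.
have sK : K * s ^+ 2 < kmin.
  have : s <= kmin / (K + 1) by rewrite ge_min lexx orbT.
  rewrite ler_pdivlMr ?ltr_wpDl // => sk; nra.
exists (r * s), (K / kmin + 1), (lam / 2); split; first exact: mulr_gt0.
- by rewrite ltr_wpDl // divr_ge0 // ltW.
- exact: divr_gt0.
move=> z zd z0.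
pose w i : R -> R := (fun t => z t i 0) - cst (c i 0).
pose V : R -> R := \sum_i (k i 0 *: (w i * w i)).
pose F t := reduced_field tau g (clamp c r (z t)).
pose dV (t : R) : R :=
  \sum_i (k i 0 *: (w i t *: F t i 0 + w i t *: F t i 0)).
have wE i t : w i t = (z t - c) i 0 by rewrite coordB.
have VE t : V t = \sum_i k i 0 * ((z t - c) i 0 * (z t - c) i 0).
  by rewrite /V fct_sumE; apply: eq_bigr => i _; rewrite -!wE.
have Vd (t : R) : 0 <= t -> is_derive t 1 V (dV t).
  move=> t0; apply: is_derive_sum => i; apply: is_deriveZ.
  have wd : is_derive t 1 (w i) (F t i 0).
    by rewrite -[F t i 0]subr0; apply: is_deriveB; exact: zd.
  exact: is_deriveM.
have Vlow t : kmin * sdot (z t - c) (z t - c) <= V t.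
  rewrite VE mulr_sumr; apply: ler_sum => i _; rewrite ler_wpM2r //.
  by rewrite -expr2 sqr_ge0.
have Vup t : V t <= kmax * sdot (z t - c) (z t - c).
  rewrite VE mulr_sumr; apply: ler_sum => i _; rewrite ler_wpM2r //.
  by rewrite -expr2 sqr_ge0.
have V00 t : 0 <= V t.
  by apply: le_trans (Vlow t); rewrite mulr_ge0 ?sdot_ge0 // ltW.
have inball t : V t < kmin * r ^+ 2 -> `|z t - c| < r.
  move=> Vt; have := le_lt_trans (Vlow t) Vt; rewrite ltr_pM2l //.
  move/(le_lt_trans (sqr_norm_le _)).
  by rewrite ltr_pXn2r ?nnegrE // ltW.
have Vnorm : V 0 <= K * `|z 0 - c| ^+ 2.
  rewrite (le_trans (Vup 0)) // -mulrA ler_wpM2l ?(ltW kmax0) // expr2.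
  by rewrite (le_trans (ler_norm _)) // sdot_le_norm.
have V0r : V 0 < kmin * r ^+ 2.
  apply: le_lt_trans Vnorm _.
  apply: (@le_lt_trans _ _ (K * (r * s) ^+ 2)).
    by rewrite ler_wpM2l // ler_pXn2r ?nnegrE ?(ltW z0) // mulr_ge0 // ltW.
  rewrite exprMn [r ^+ 2 * _]mulrC mulrA ltr_pM2r ?exprn_gt0 //.
have dVle t : 0 <= t -> V t < kmin * r ^+ 2 -> dV t <= - lam * V t.
  move=> t0 /inball /ltW zr.
  have FE : F t = reduced_field tau g (z t) by rewrite /F clamp_id.
  set d := z t - c in zr.
  have dVE : dV t = sdot d (g (z t)) +
      \sum_i (d i 0 * d i 0 * (g (z t) i 0 * ci i 0)).
    rewrite /sdot -big_split; apply: eq_bigr => i _ /=.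
    rewrite FE wE -/d !mxE /GRing.scale /=.
    have -> : z t i 0 = d i 0 + c i 0 by rewrite coordB subrK.
    by field; rewrite !gt_eqF.
  have cubic : \sum_i (d i 0 * d i 0 * (g (z t) i 0 * ci i 0)) <=
      mu / 2 * sdot d d.
    rewrite mulr_sumr; apply: ler_sum => i _.
    rewrite [leRHS]mulrC ler_wpM2l //; first by rewrite -expr2 sqr_ge0.
    apply: le_trans rmu; rewrite (le_trans (ler_norm _)) // normrM mulrA.
    rewrite ler_pM ?norm_coord // (le_trans (norm_coord _ _ _)) //.
    rewrite -[g _]subr0 -gc (le_trans (gL _ _)) // mulrC.
    by rewrite ler_wpM2r.
  have h1 : lam * V t <= mu / 2 * sdot d d.
    rewrite (le_trans (ler_wpM2l (ltW lam0) (Vup t))) // mulrA.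
    rewrite ler_wpM2r ?sdot_ge0 //.
    by rewrite /lam le_eqVlt; apply/orP; left; apply/eqP; field; rewrite gt_eqF.
  have := mono (z t); rewrite -/d dVE mulNr; lra.
move=> t t0.
have [Vt decay] := barrier_decay Vd (fun t _ => V00 t) lam0 V0r dVle t0.
split; first exact: inball.
pose e := expR (- (lam / 2) * t).
have e0 : 0 <= e := expR_ge0 _.
have eE : expR (- lam * t) = e ^+ 2.
  by rewrite /e expr2 -expRD; congr expR; field.
have Kk0 : 0 <= K / kmin by rewrite divr_ge0 // ltW.
have C1 : 1 <= K / kmin + 1 by rewrite lerDr.
rewrite -(ler_pXn2r (n := 2)) ?nnegrE //; last first.
  by rewrite !mulr_ge0 // ltW // (lt_le_trans ltr01).
rewrite (le_trans (sqr_norm_le _)) // -(ler_pM2l kmin0) (le_trans (Vlow t)) //.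
rewrite (le_trans decay) // eE (le_trans (ler_wpM2r (sqr_ge0 e) Vnorm)) //.
have KE : K <= kmin * (K / kmin + 1) ^+ 2.
  have {1}-> : K = kmin * (K / kmin) by rewrite mulrCA divff ?gt_eqF // mulr1.
  by rewrite ler_pM2l //; nra.
rewrite -/e; set p := K / kmin + 1 in KE *; set N := `|_|.
have -> : kmin * (p * e * N) ^+ 2 = kmin * p ^+ 2 * (N ^+ 2 * e ^+ 2) by ring.
by rewrite -[leLHS]mulrA ler_wpM2r // mulr_ge0 ?sqr_ge0.
Qed.

(** Elimination of the load voltages by [phi] reduces existence to the ordinary
    differential equation of the inverter voltages; conversely, continuity keeps
    every solution on the graph of [phi] for a short time. *)
Lemma zip_stable (R : realType) (n m : nat) (H : 'M[R]_(n + m))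
    (J xe : 'cV[R]_(n + m)) (q : 'cV[R]_n) (tau : 'cV[R]_m) (mu a eps : R) :
  pos_vec tau -> 0 < mu -> coercive mu H -> 0 < eps ->
  ulsubmx H \in unitmx -> 0 <= a ->
  (forall z : 'cV[R]_n, `|invmx (ulsubmx H) *m z| <= a * `|z|) ->
  a * (`|q| / eps ^+ 2) <= 2^-1 -> `|q| / eps ^+ 2 <= mu / 2 ->
  (forall i, eps < usubmx xe i 0) -> pos_vec (dsubmx xe) ->
  dae_equilibrium (zip_rhs H J q) xe ->
  locally_exponentially_stable tau (zip_rhs H J q) xe.
Proof.
move=> tau0 mu0 cH e0 uH a0 hH small1 small2 xLe c0 eqxe; split=> //.
have [phi [C [C0 phiL phiE]]] := load_map_exists J uH e0 hH small1 a0.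
set xL := usubmx xe in xLe; set c := dsubmx xe in c0.
pose st z := col_mx (phi z) z.
pose g z := dsubmx (J - H *m st z).
have bal_xe : load_balance H J q eps xe.
  by apply/(load_balance_zip_rhs H J q e0 xLe); rewrite -eqxe linear0.
have xLE : xL = phi c by apply/phiE; rewrite vsubmxK.
have stc : st c = xe by rewrite /st -xLE vsubmxK.
have stL z z' : `|st z - st z'| <= (C + 1) * `|z - z'|.
  rewrite /st opp_col_mx add_col_mx (le_trans (norm_col_mx _ _)) //.
  by rewrite mulrDl mul1r lerD2r.
have gc : g c = 0.
  apply/colP => i; have := congr1 (fun M => dsubmx M i 0) eqxe.
  rewrite dsubmx_zip_rhs linear0 -/c -{1}stc -/(g c) => /esym/eqP.
  rewrite [X in _ == X]mxE mulf_eq0 (gt_eqF (c0 i)) /= => /eqP ->.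
  by rewrite mxE.
have [CH CH0 hCH] := mulmx_bounded H.
have gB z z' : g z - g z' = - dsubmx (H *m (st z - st z')).
  rewrite /g -linearB /=.
  have -> : J - H *m st z - (J - H *m st z') = - (H *m (st z - st z')).
    by rewrite mulmxBr; apply/colP => i; rewrite !(coordB, mxE); ring.
  by rewrite linearN.
have gL z z' : `|g z - g z'| <= CH * (C + 1) * `|z - z'|.
  rewrite gB normrN (le_trans (norm_dsubmx _)) // (le_trans (hCH _)) //.
  by rewrite -mulrA ler_wpM2l.
have Lg0 : 0 <= CH * (C + 1) by rewrite mulr_ge0 // addr_ge0.
have mono z : mu / 2 * sdot (z - c) (z - c) <= - sdot (z - c) (g z).
  have bz : load_balance H J q eps (st z) by apply/phiE.
  have := load_balance_monotone e0 mu0 cH small2 bz bal_xe.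
  have -> : dsubmx (st z - xe) = z - c by rewrite linearB /= col_mxKd.
  have -> : dsubmx (H *m (st z - xe)) = - g z.
    by rewrite -stc -[LHS]opprK -gB gc subr0.
  by rewrite sdotNr.
(* Load voltages within gap of xL exceed eps, so that truncation is void. *)
have [gap gap0 gapE] : exists2 gap, 0 < gap & forall i, gap <= xL i 0 - eps.
  by apply: exists_pos_lower_bound => i; rewrite subr_gt0.
have upos (x : 'cV[R]_n) : `|x - xL| < gap -> forall i, eps < x i 0.
  move=> xg i; have := le_lt_trans (norm_coord (x - xL) i 0) xg.
  have := gapE i; rewrite coordB ltr_norml => h /andP[]; lra.
have C1 : 0 < C + 1 by rewrite ltr_wpDl.
have [|r /andP[r0 rgap] [d [Cd [lam [d0 Cd0 lam0 decay]]]]] :=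
  reduced_decay tau0 c0 Lg0 gL gc (ltac:(exact: divr_gt0) : 0 < mu / 2) mono
    (r0 := gap / (C + 1)); first exact: divr_gt0.
have [L L0 FL] := reduced_field_clamp_lip tau c (ltW r0) Lg0 gL.
have phi_gap z : `|z - c| <= r -> `|phi z - xL| < gap.
  move=> zr; rewrite xLE (le_lt_trans (phiL _ _)) //.
  have : r * (C + 1) <= gap by rewrite -ler_pdivlMr.
  have := ler_wpM2l C0 zr; lra.
have on_graph E : 0 = usubmx (zip_rhs H J q E) -> `|usubmx E - xL| < gap ->
    E = st (dsubmx E).
  move=> hE Eg; have /(load_balance_zip_rhs H J q e0 (upos _ Eg)) := hE.
  by rewrite -{1}(vsubmxK E) => /phiE uE; rewrite /st -uE vsubmxK.
exists (Num.min gap d), ((C + 1) * Cd), lam; split => //.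
- by rewrite lt_min gap0.
- exact: mulr_gt0.
move=> x0 cons; rewrite lt_min => /andP[x0gap x0d].
have x0E : x0 = st (dsubmx x0).
  apply: on_graph => //; apply: le_lt_trans x0gap.
  by rewrite /xL -linearB norm_usubmx.
have [z [z0 zd]] := ode_global_solution (dsubmx x0) L0 FL.
have z0c : `|z 0 - c| <= `|x0 - xe| by rewrite z0 /c -linearB norm_dsubmx.
have zdec := decay z zd (le_lt_trans z0c x0d).
have zr t : 0 <= t -> `|z t - c| <= r by move=> /zdec[/ltW].
have zc t : 0 <= t -> {for t, continuous z}.
  move=> t0; apply: continuous_coordP => i.
  exact: is_derive_continuous (zd t i t0).
have xc : {within `[0, +oo[, continuous (st \o z)}.
  apply/subspace_continuousP => t; rewrite /= in_itv /= andbT => t0.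
  apply: cvg_within_filter.
  exact: lipschitz_continuous_comp C1 stL (zc t t0).
have xsol : dae_solution tau (zip_rhs H J q) (st \o z).
  split=> // t t0; exists (reduced_field tau g (z t)).
    apply: halfline_derivative_coord => i.
    have -> : (fun s => dsubmx ((st \o z) s) i 0) = fun s => z s i 0.
      by apply/funext => s; rewrite /= col_mxKd.
    by have := zd t i t0; rewrite clamp_id // zr.
  rewrite -[RHS]vsubmxK; congr col_mx.
    apply/(load_balance_zip_rhs H J q e0); last exact/phiE.
    by rewrite col_mxKu; apply/upos/phi_gap/zr.
  apply/colP => i; rewrite dsubmx_zip_rhs mul_dgE /= col_mxKd -/(g _).
  by rewrite mxE mulrC divfK // gt_eqF.
exists (st \o z); split=> //.
- by rewrite /= z0 -x0E.
- move=> y y0 [yc yd].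
  apply: real_induction.
  + by rewrite y0 /= z0 -x0E.
  (* Near t, both solutions follow the reduced field, so they agree after t. *)
  + move=> t t0 yt.
    have zt := (zdec t t0).1; have pt := phi_gap _ (ltW zt).
    have [|eta eta0 near_t] := @halfline_continuous_near _ _ y t
      (Num.min (r - `|z t - c|) (gap - `|phi (z t) - xL|)) yc t0.
      by rewrite lt_min !subr_gt0 zt.
    have ynear s : t <= s -> s < t + eta ->
        `|dsubmx (y s) - c| <= r /\ y s = st (dsubmx (y s)).
      move=> ts st_; have s0 := le_trans t0 ts.
      have : `|y t - y s| < Num.min (r - `|z t - c|) (gap - `|phi (z t) - xL|).
        by apply: near_t => //; rewrite distrC ger0_norm ?subr_ge0 // ltrBlDl.
      rewrite lt_min => /andP[yr yg]; split.
        rewrite -[dsubmx (y s)](subrK (z t)) -addrA.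
        have -> : dsubmx (y s) - z t = dsubmx (y s - y t).
          by rewrite yt linearB /= col_mxKd.
        rewrite (le_trans (ler_normD _ _)) //.
        by have := norm_dsubmx (y s - y t); rewrite distrC in yr; lra.
      apply: on_graph.
        have [v _ /(congr1 usubmx)] := yd s s0; by rewrite col_mxKu.
      rewrite -[usubmx (y s)](subrK (phi (z t))) -addrA.
      have -> : usubmx (y s) - phi (z t) = usubmx (y s - y t).
        by rewrite yt linearB /= col_mxKu.
      rewrite (le_lt_trans (ler_normD _ _)) //.
      by have := norm_usubmx (y s - y t); rewrite distrC in yg; lra.
    exists eta => // s ts st_.
    have [_ ->] := ynear s (ltW ts) st_; rewrite /=; congr st.
    have sub : `[t, s] `<=` `[0, +oo[.
      by apply: subset_itv; rewrite bnd_simp.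
    have dsub1 (x x' : 'cV[R]_(n + m)) :
        `|dsubmx x - dsubmx x'| <= 1 * `|x - x'|.
      by rewrite mul1r -linearB norm_dsubmx.
    apply: (lipschitz_ode_unique (u := dsubmx \o y) (v := z) L0 FL (ltW ts)).
    * move=> s'; apply: (lipschitz_continuous_comp
        (y := (y : subspace `[t, s] -> _)) ltr01 dsub1).
      exact: (continuous_subspaceW sub yc).
    * apply/subspace_continuousP => s'; rewrite /= in_itv /= => /andP[ts' _].
      by apply: cvg_within_filter; apply: zc; exact: le_trans ts'.
    * move=> s' i ts' s's; have s'0 := le_lt_trans t0 ts'.
      have [v vd vE] := yd s' (ltW s'0).
      have [yr yE] := ynear s' (ltW ts') (lt_trans s's st_).
      have := halfline_derivative_is_derive i s'0 vd.
      have -> // : v i 0 =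
          reduced_field tau g (clamp c r ((dsubmx \o y) s')) i 0.
      rewrite /= clamp_id // [RHS]mxE /g -yE -(dsubmx_zip_rhs _ _ q) -vE.
      rewrite col_mxKd mul_dgE.
      by rewrite mulrAC divff ?mul1r // gt_eqF.
    * by move=> s' i ts' _; apply: zd; apply: ltW; exact: le_lt_trans ts'.
    * by rewrite /= yt /= col_mxKd.
  (* Agreement before t passes to t by continuity. *)
  + move=> t t0 below; apply/eqP; rewrite -subr_eq0 -normr_le0 leNgt.
    apply/negP => yx0.
    have [e1 e10 h1] := halfline_continuous_near yc (ltW t0)
      (ltac:(exact: divr_gt0) : 0 < `|y t - (st \o z) t| / 2).
    have [e2 e20 h2] := halfline_continuous_near xc (ltW t0)
      (ltac:(exact: divr_gt0) : 0 < `|y t - (st \o z) t| / 2).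
    pose s := Num.max 0 (t - Num.min e1 e2 / 2).
    have e12 : 0 < Num.min e1 e2 by rewrite lt_min e10.
    have s0 : 0 <= s by rewrite le_max lexx.
    have st_ : s < t by rewrite gt_max t0; lra.
    have : `|t - s| < Num.min e1 e2.
      rewrite gtr0_norm ?subr_gt0 //.
      have : t - Num.min e1 e2 / 2 <= s by rewrite le_max lexx orbT.
      lra.
    rewrite lt_min => /andP[/(h1 s s0) n1 /(h2 s s0) n2].
    have := ler_normB (y t - y s) ((st \o z) t - (st \o z) s).
    rewrite (below s s0 st_) in n1 *.
    rewrite opprB addrA subrK; lra.
- move=> t t0; have [_ zt] := zdec t t0.
  rewrite -[X in _ - X]stc (le_trans (stL _ _)) // -!mulrA.
  rewrite ler_wpM2l ?(ltW C1) //.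
  rewrite (le_trans zt) // -mulrA ler_wpM2l ?(ltW Cd0) //.
  by rewrite ler_wpM2l ?expR_ge0.
Qed.

(** * Equilibria of the network *)

Lemma closed_loop_rhsE (R : comUnitRingType) (n m : nat) (B : 'M[R]_(n + m))
    (K EIstar : 'cV[R]_m) (b I q : 'cV[R]_n) E :
  closed_loop_rhs B K EIstar b I q E
  = zip_rhs (augmented B b K) (col_mx I (- (dg K *m EIstar))) q E.
Proof.
rewrite /closed_loop_rhs /zip_rhs /augmented.
apply/colP => i; rewrite -!mulmxA mulNmx opprK mulmxDl.
rewrite coordD coordD mul_dgE mul_dgE !coordD mul_dgE.
case: (split_ordP i) => j ->.
  rewrite !col_mxEu /QL_ZIP !coordD -mulmxA !mul_dgE [usubmx E j 0]mxE; ring.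
rewrite !col_mxEd !mul_dgE coordB [dsubmx E j 0]mxE coordN mul_dgE.
have -> : (0 : 'cV[R]_m) j 0 = 0 by rewrite mxE.
ring.
Qed.

Lemma reduced_power_flowP (R : realFieldType) (n m : nat)
    (B : 'M[R]_(n + m)) (K EIstar : 'cV[R]_m) (b I q x : 'cV[R]_n) :
  reduced_power_flow B K EIstar b I q x <->
  forall i, x i 0 * (- (Bred B K + dg b) *m x -
    (I - Bred B K *m ELstar B K EIstar)) i 0 = q i 0.
Proof.
rewrite /reduced_power_flow /QL_ZIP -!mulmxA mulmxBr.
set f := Bred B K *m ELstar _ _ _.
set z := _ *m x - (I - f).
have rhsE i : (dg x *m (dg b *m x) + dg x *m I + q +
    dg x *m (Bred B K *m x - f)) i 0 = q i 0 - x i 0 * z i 0.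
  have -> : z i 0 = f i 0 - (Bred B K *m x) i 0 - b i 0 * x i 0 - I i 0.
    rewrite /z coordB mulNmx coordN (mulmxDl (Bred B K)) coordD mul_dgE.
    rewrite coordB; ring.
  rewrite !coordD !mul_dgE.
  rewrite coordB; ring.
split=> [h i|h].
  have := congr1 (fun M : 'cV_n => M i 0) h; rewrite rhsE mxE => /esym/eqP.
  by rewrite subr_eq0 => /eqP ->.
by apply/colP => i; rewrite rhsE mxE h subrr.
Qed.

Lemma Bred_ELstar (R : realFieldType) (n m : nat) (B : 'M[R]_(n + m))
    (K EIstar : 'cV[R]_m) : Bred B K \in unitmx ->
  Bred B K *m ELstar B K EIstar =
  - (ursubmx B *m (invmx (drsubmx B + dg K) *m (dg K *m EIstar))).
Proof. by move=> uB; rewrite /ELstar /W1 mulNmx mulmxN -!mulmxA mulKVmx. Qed.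

Lemma mul_EI_of (R : realFieldType) (n m : nat) (B : 'M[R]_(n + m))
    (K EIstar : 'cV[R]_m) x : drsubmx B + dg K \in unitmx ->
  (drsubmx B + dg K) *m EI_of B K EIstar x =
  dg K *m EIstar - dlsubmx B *m x.
Proof.
move=> uM.
by rewrite /EI_of /W2 -mulmxA mulKVmx // mul_row_col mulNmx addrC.
Qed.

(** [- (drsubmx B + dg K)] is a coercive matrix with nonpositive off-diagonal
    entries, and it maps [EI_of B K EIstar x] to
    [dlsubmx B *m x - dg K *m EIstar > 0]. *)
Lemma EI_of_pos (R : realFieldType) (n m : nat) (e : rel 'I_(n + m))
    (B : 'M[R]_(n + m)) (K EIstar : 'cV[R]_m) x :
  susceptance_matrix e B -> (forall i, K i 0 < 0) ->
  pos_vec x -> pos_vec EIstar -> pos_vec (EI_of B K EIstar x).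
Proof.
move=> hB hK x0 EI0; have [k k0 ck] := inverter_block_coercive hB hK.
apply: (coercive_Zmatrix_pos k0 ck) => [i j ij|i].
  rewrite mxE oppr_le0 mxE dgE (negPf ij) addr0 !mxE.
  by apply: (susceptance_offdiag hB); rewrite eq_shift.
rewrite mulNmx mul_EI_of ?(inverter_block_unit hB) // opprB coordB mul_dgE.
rewrite subr_gt0; apply: (@lt_le_trans _ _ 0); first by rewrite nmulr_rlt0.
rewrite mxE; apply: sumr_ge0 => j _; rewrite mulr_ge0 ?(ltW (x0 _)) // !mxE.
by apply: (susceptance_offdiag hB); rewrite eq_shift.
Qed.

(** Kron reduction: eliminating the inverter rows of the augmented matrix turns
    its load rows into those of the reduced power flow. *)
Lemma reduced_power_flow_equilibrium (R : realType) (n m : nat)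
    (B : 'M[R]_(n + m)) (K EIstar : 'cV[R]_m) (b I q x : 'cV[R]_n) :
  drsubmx B + dg K \in unitmx -> Bred B K \in unitmx ->
  reduced_power_flow B K EIstar b I q x ->
  dae_equilibrium (zip_rhs (augmented B b K) (col_mx I (- (dg K *m EIstar))) q)
    (col_mx x (EI_of B K EIstar x)).
Proof.
move=> uM uB /reduced_power_flowP flow.
rewrite /dae_equilibrium -[RHS]vsubmxK.
rewrite -[LHS](vsubmxK (0 : 'cV[R]_(n + m))) !linear0.
have BredE : Bred B K *m x = ulsubmx B *m x -
    ursubmx B *m (invmx (drsubmx B + dg K) *m (dlsubmx B *m x)).
  by rewrite /Bred mulmxBl -!mulmxA.
have urE : ursubmx B *m EI_of B K EIstar x = - (Bred B K *m ELstar B K EIstar) -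
    ursubmx B *m (invmx (drsubmx B + dg K) *m (dlsubmx B *m x)).
  by rewrite Bred_ELstar // opprK -mulmxBr -mulmxBr -mul_EI_of // mulKmx.
congr col_mx; apply/colP => i; rewrite mxE.
  rewrite usubmx_zip_rhs col_mxKu.
  have -> : usubmx (col_mx I (- (dg K *m EIstar)) -
      augmented B b K *m col_mx x (EI_of B K EIstar x)) =
      - (- (Bred B K + dg b) *m x - (I - Bred B K *m ELstar B K EIstar)).
    rewrite linearB /= col_mxKu usubmx_mul_col augmentedE block_mxKul.
    rewrite block_mxKur (mulNmx (Bred B K + _)) (mulmxDl (Bred B K)) BredE.
    rewrite (mulNmx (ulsubmx B + _)) (mulmxDl (ulsubmx B)).
    rewrite (mulNmx (ursubmx B)) urE.
    apply/colP => j; rewrite !(coordB, coordD, coordN). ring.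
  by rewrite coordN mulrN flow addNr.
rewrite dsubmx_zip_rhs col_mxKd.
have -> : dsubmx (col_mx I (- (dg K *m EIstar)) -
    augmented B b K *m col_mx x (EI_of B K EIstar x)) = 0.
  rewrite linearB /= col_mxKd augmentedE mul_block_col col_mxKd !mulNmx.
  rewrite mul_EI_of //; apply/colP => j.
  by rewrite [RHS]mxE !(coordB, coordD, coordN); ring.
by rewrite [X in _ * X]mxE mulr0.
Qed.

Lemma ulsubmx_coercive (R : realFieldType) (n m : nat) (H : 'M[R]_(n + m)) mu :
  coercive mu H -> coercive mu (ulsubmx H).
Proof.
move=> cH x; have := cH (col_mx x 0).
rewrite -{1}(submxK H) mul_block_col !sdot_col !mulmx0 !addr0.
by rewrite sdot0r addr0 [sdot 0 _]sdotC sdot0r addr0.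
Qed.

Lemma dg_unit (R : realFieldType) (n : nat) (u : 'cV[R]_n) :
  pos_vec u -> dg u \in unitmx.
Proof.
move=> u0; apply: mulmx_inj_unit => x ux; apply/colP => i.
have := congr1 (fun M : 'cV_n => M i 0) ux; rewrite mul_dgE mxE => /eqP.
by rewrite mulf_eq0 gt_eqF //= => /eqP.
Qed.

(** * Expansion and stability for small constant-power demand *)

(** Multiplying the error by [Qs = - dg u A dg u] leaves the entrywise product
    of [x - u] and [trunc_current eps q x], both of which are [O(|q|)]. *)
Lemma short_circuit_expansion (R : realType) (n : nat) (A : 'M[R]_n)
    (u : 'cV[R]_n) (eps a : R) :
  A \in unitmx -> pos_vec u -> 0 < eps -> 0 <= a ->
  (forall z : 'cV[R]_n, `|invmx A *m z| <= a * `|z|) ->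
  let Qs := dg u *m (- A) *m dg u in
  exists2 C : R, 0 < C & forall q x : 'cV[R]_n, (forall i, eps < x i 0) ->
    A *m (x - u) = trunc_current eps q x ->
    exists2 err : 'cV[R]_n, x = dg u *m (ones R n - invmx Qs *m q + err) &
      `|err| <= C * `|invmx Qs *m q| ^+ 2.
Proof.
move=> uA u0 e0 a0 hA Qs.
have QsU : Qs \in unitmx by rewrite !unitmx_mul unitmxN uA (dg_unit u0).
have [s s0 hs] := mulmx_bounded (invmx Qs).
have [s' s'0 hs'] := mulmx_bounded Qs.
pose C := s * (a * (eps ^- 2 * s' ^+ 2)).
have C0 : 0 <= C by rewrite !mulr_ge0 // ?invr_ge0 ?exprn_ge0 // ltW.
exists (C + 1) => [|q x xe Ax]; first by rewrite ltr_wpDl.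
set t := trunc_current eps q x in Ax.
pose d := x - u.
pose rel : 'cV[R]_n := \col_i (d i 0 / u i 0).
pose td : 'cV[R]_n := \col_i (t i 0 * d i 0).
have ui i : u i 0 != 0 by rewrite gt_eqF.
have urel : dg u *m rel = d.
  by apply/colP => i; rewrite mul_dgE mxE mulrC divfK.
have errE : rel + invmx Qs *m q = invmx Qs *m td.
  apply: (can_inj (mulKmx QsU)); rewrite mulmxDr !mulKVmx // /Qs -!mulmxA urel.
  rewrite mulNmx Ax; apply/colP => i; rewrite coordD mul_dgE coordN [RHS]mxE.
  have xt : x i 0 * t i 0 = q i 0 by apply/(trunc_current_eq _ _ e0 (xe i)).
  by rewrite -xt /d coordB; ring.
exists (invmx Qs *m td).
  rewrite -errE addrCA subrK mulmxDr urel.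
  apply/colP => i; rewrite coordD mul_dgE coordB [ones R n i 0]mxE.
  by rewrite mulr1 subrK.
have qle : `|q| <= s' * `|invmx Qs *m q|.
  by apply: le_trans (hs' _); rewrite mulKVmx.
have tle : `|t| <= `|q| / eps by exact: trunc_current_norm.
have dle : `|d| <= a * (`|q| / eps).
  rewrite -[d](mulKmx uA) Ax (le_trans (hA _)) // ler_wpM2l //.
have tdle : `|td| <= a * (eps ^- 2 * `|q| ^+ 2).
  apply: cvnorm_le => [|i].
    by rewrite !mulr_ge0 // ?invr_ge0 ?exprn_ge0 // ltW.
  rewrite mxE normrM.
  have h1 := le_trans (norm_coord t i 0) tle.
  have h2 := le_trans (norm_coord d i 0) dle.
  rewrite (le_trans (ler_pM (normr_ge0 _) (normr_ge0 _) h1 h2)) //.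
  by rewrite le_eqVlt; apply/orP; left; apply/eqP; field; rewrite gt_eqF.
rewrite (le_trans (hs _)) // mulrDl mul1r ler_wpDr ?sqr_ge0 // /C -mulrA.
rewrite ler_wpM2l // (le_trans tdle) // -!mulrA ler_wpM2l // ler_wpM2l //.
  by rewrite invr_ge0 exprn_ge0 // ltW.
by rewrite mulrA -expr2 -exprMn ler_pXn2r ?nnegrE // mulr_ge0.
Qed.

Theorem mainTheorem4 (R : realType) (n m : nat) (hn : (0 < n)%N)
  (hm : (0 < m)%N)
  (e : rel 'I_(n + m)) (he : connected_graph e)
  (B : 'M[R]_(n + m)) (hB : susceptance_matrix e B)
  (K : 'cV[R]_m) (hK : forall i, K i 0 < 0)
  (tau : 'cV[R]_m) (htau : pos_vec tau)
  (EIstar : 'cV[R]_m) (hEIstar : pos_vec EIstar)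
  (b_shunt I_shunt : 'cV[R]_n)
  (hM : M_matrix (- (Bred B K + dg b_shunt)))
  (hI : forall i, (Bred B K *m ELstar B K EIstar) i 0 < I_shunt i 0) :
  let EZI := EL_ZI B K EIstar b_shunt I_shunt in
  let Qs := Qsc B K EIstar b_shunt I_shunt in
  pos_vec EZI /\
  exists (delta c : R) (U : set 'cV[R]_n),
    [/\ 0 < delta, 0 < c, nbhs EZI U, (forall E, U E -> pos_vec E) &
      forall QL : 'cV[R]_n, `|QL| < delta ->
        exists EZIP : 'cV[R]_n,
          [/\ unique (fun EL =>
                U EL /\
                reduced_power_flow B K EIstar b_shunt I_shunt QL EL) EZIP,
              (exists2 eps : 'cV[R]_n,
                EZIP = dg EZI *m (ones R n - invmx Qs *m QL + eps) &
                `|eps| <= c * `|invmx Qs *m QL| ^+ 2) &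
              locally_exponentially_stable tau
                (closed_loop_rhs B K EIstar b_shunt I_shunt QL)
                (col_mx EZIP (EI_of B K EIstar EZIP))]].
Proof.
move=> EZI Qs.
have [symB _ _ _] := hB.
have BredU : Bred B K \in unitmx := Bred_unit hm he hB hK.
set A := - (Bred B K + dg b_shunt) in hM.
pose H := augmented B b_shunt K.
pose y0 := I_shunt - Bred B K *m ELstar B K EIstar.
have symA : A^T = A by rewrite /A linearN linearD /= tr_dg tr_Bred.
have [al al0 cA] := sym_M_matrix_coercive symA hM.
have [k k0 ck] := inverter_block_coercive hB hK.
have HdrE : drsubmx H = - (drsubmx B + dg K).
  by rewrite /H augmentedE block_mxKdr.
have schurE := augmented_schur b_shunt (inverter_block_unit hB hK).
have [mu mu0 cH] : exists2 mu, 0 < mu & coercive mu H.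
  apply: (schur_coercive (tr_augmented b_shunt K symB) al0 k0).
    by rewrite HdrE.
  by rewrite schurE.
have uA := coercive_unit al0 cA.
have uH := coercive_unit mu0 (ulsubmx_coercive cH).
have [aA aA0 hA] := mulmx_bounded (invmx A).
have [aH aH0 hH] := mulmx_bounded (invmx (ulsubmx H)).
have EZIE : A *m EZI = y0.
  rewrite /EZI /EL_ZI -[Bred B K + _]opprK -/A invmxN //.
  by rewrite (mulNmx (invmx A)) mulmxN mulKVmx // opprB.
have EZI0 : pos_vec EZI.
  apply: (coercive_Zmatrix_pos al0 cA); first by case: hM.
  by move=> i; rewrite EZIE coordB subr_gt0.
split=> //.
(* On the ball of radius eps around EZI all voltages exceed eps. *)
have [eps eps0 epsE] : exists2 eps, 0 < eps & forall i, eps <= EZI i 0 / 2.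
  by apply: exists_pos_lower_bound => i; rewrite divr_gt0.
pose a := aA + aH.
have a0 : 0 <= a by rewrite addr_ge0.
have hAa (z : 'cV[R]_n) : `|invmx A *m z| <= a * `|z|.
  by rewrite (le_trans (hA z)) // ler_wpM2r // lerDl.
have hHa (z : 'cV[R]_n) : `|invmx (ulsubmx H) *m z| <= a * `|z|.
  by rewrite (le_trans (hH z)) // ler_wpM2r // lerDr.
(* |q| < kappa eps^2 makes both load equations contractions of factor 1 / 2, and
   leaves half of the coercivity of H in load_balance_monotone. *)
pose kappa := Num.min (2^-1 / (a + 1)) (mu / 2).
have a1 : 0 < a + 1 by rewrite ltr_wpDl.
have kappa0 : 0 < kappa by rewrite lt_min !divr_gt0 // invr_gt0.
have kappaa : a * kappa <= 2^-1.
  have : kappa * (a + 1) <= 2^-1 by rewrite -ler_pdivlMr // ge_min lexx.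
  nra.
have kappamu : kappa <= mu / 2 by rewrite ge_min lexx orbT.
have Ueps E : ball EZI eps E -> forall i, eps < E i 0.
  rewrite -ball_normE /= => h i.
  have := le_lt_trans (norm_coord (EZI - E) i 0) h.
  by have := epsE i; rewrite coordB ltr_norml => h1 /andP[]; lra.
have [c c0 hc] := short_circuit_expansion uA EZI0 eps0 a0 hAa.
exists (kappa * eps ^+ 2), c, (ball EZI eps); split=> //.
- by rewrite mulr_gt0 ?exprn_gt0.
- exact: nbhsx_ballx.
- by move=> E /Ueps h i; exact: lt_trans (h i).
move=> q; rewrite -ltr_pdivrMr ?exprn_gt0 // => qlt.
have small : a * (`|q| / eps ^+ 2) <= 2^-1.
  by apply: le_trans kappaa; rewrite ler_wpM2l // ltW.
have small2 : `|q| / eps ^+ 2 <= mu / 2 by apply: le_trans kappamu; exact: ltW.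
have [x xE] := trunc_solution_exists y0 uA eps0 hAa small a0.
have flowE E : ball EZI eps E ->
    reduced_power_flow B K EIstar b_shunt I_shunt q E <->
    A *m E = y0 + trunc_current eps q E.
  move=> /Ueps Ee; split=> [/reduced_power_flowP h|h].
    apply/colP => i.
    have t : (A *m E - y0) i 0 = trunc_current eps q E i 0.
      by apply/(trunc_current_eq _ _ eps0 (Ee i)); exact: h.
    by rewrite [RHS]coordD -t (coordB (A *m E)) addrC subrK.
  apply/reduced_power_flowP => i; apply/(trunc_current_eq _ _ eps0 (Ee i)).
  by rewrite -/A -/y0 h [y0 + _]addrC addrK.
have Axu : A *m (x - EZI) = trunc_current eps q x.
  by rewrite mulmxBr xE EZIE addrC addKr.
have xU : ball EZI eps x.
  rewrite -ball_normE /= distrC -[x - EZI](mulKmx uA) Axu.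
  rewrite (le_lt_trans (hAa _)) //.
  apply: (@le_lt_trans _ _ (a * (`|q| / eps))).
    by rewrite ler_wpM2l // trunc_current_norm.
  have -> : a * (`|q| / eps) = a * (`|q| / eps ^+ 2) * eps.
    by field; rewrite gt_eqF.
  have := ler_wpM2r (ltW eps0) small; lra.
have xflow := (flowE x xU).2 xE.
exists x; split.
- split=> [//|E [EU /(flowE _ EU) EE]].
  apply/eqP; rewrite -subr_eq0 -normr_le0.
  rewrite (le_trans (trunc_solution_lip uA eps0 hAa small a0 xE EE)) //.
  by rewrite subrr normr0 mulr0.
- have QsE : Qs = dg EZI *m (- A) *m dg EZI by rewrite /Qs /Qsc /A opprK.
  by rewrite QsE; apply: hc => //; exact: Ueps.
- have -> : closed_loop_rhs B K EIstar b_shunt I_shunt q =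
      zip_rhs H (col_mx I_shunt (- (dg K *m EIstar))) q.
    by apply/funext => E; exact: closed_loop_rhsE.
  apply: (zip_stable htau mu0 cH eps0 uH a0 hHa small small2).
  + by rewrite col_mxKu; exact: Ueps.
  + rewrite col_mxKd; apply: (EI_of_pos hB hK) => // i.
    exact: lt_trans (Ueps _ xU i).
  + apply: reduced_power_flow_equilibrium => //.
    exact: inverter_block_unit hB hK.
Qed.
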